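(* Let $0<s_0<1$ and let $f\in C^\infty(\mathbb{R})$ satisfy $f(s)=0$ for $s\le0$ and $f(s)=1$ for $s\ge s_0$. The diffracted wave $u_d(\rho,\theta,t)$, $\rho>0$, $\theta\in\Theta$, of the nonstationary NN-scattering problem on the wedge $W$, i.e. the inverse Fourier–Laplace transform $u_d(\rho,\theta,\cdot)=F^{-1}_{\omega\to t}[\widehat{u}_d(\rho,\theta,\omega)]$ of $$\widehat{u}_d(\rho,\theta,\omega)=\frac{i}{4\Phi}\,\widehat{g}(\omega)\int_{\mathcal{C}_0}e^{-\rho\omega\sinh\beta}H_N(\beta+i\theta)\,d\beta,\qquad\omega\in\mathbb{C}^+,$$ admits the representation $$u_d(\rho,\theta,t)=\frac{i\,e^{-i\omega_0t}}{4\Phi}\int_{-\infty}^{+\infty}e^{i\omega_0\rho\cosh\beta}\,Z_N(\beta+i\theta)\,f(t-\rho\cosh\beta)\,d\beta,\qquad t\in\mathbb{R}.$$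
   Context: $\mathbb{C}^+=\{z\in\mathbb{C}:\operatorname{Im}z>0\}$. Fix $\omega_0>0$, $\phi\in(0,\pi)$, $\Phi:=2\pi-\phi\in(\pi,2\pi)$, $q:=\pi/(2\Phi)$, and $\alpha$ with $\max\{\phi-\frac{\pi}{2},0\}<\alpha<\min\{\frac{\pi}{2},\phi\}$. The wedge is $W=\{(\rho\cos\theta,\rho\sin\theta):\rho\ge0,\ 0\le\theta\le\phi\}$, $Q=\mathbb{R}^2\setminus W$. The incident wave is $u_{in}(y,t)=e^{i\omega_0(\mathbf{n_0}\cdot y-t)}f(t-\mathbf{n_0}\cdot y)$, $\mathbf{n_0}=(\cos\alpha,\sin\alpha)$, and the scattered wave $u_s$ solves $(\partial_t^2-\Delta)u_s=0$ in $Q$ for $t>0$, $\partial_{\mathbf n}u_s=-\partial_{\mathbf n}u_{in}$ on $\partial Q$, with zero Cauchy data at $t=0$; its Fourier–Laplace transform in $t$ splits as a reflected part plus the diffracted part $\widehat{u}_d$ given in the claim. Put $\theta_1:=2\phi-\alpha$, $\theta_2:=2\pi-\alpha$, $\Theta:=[\phi,2\pi]\setminus\{\theta_1,\theta_2\}$, and $$H_N(\beta):=\coth\left[q\left(\beta+\tfrac{i\pi}{2}-i\alpha\right)\right]+\coth\left[q\left(\beta-\tfrac{3i\pi}{2}+i\alpha\right)\right],$$ $$Z_N(\beta):=H_N\left(\beta-\tfrac{5i\pi}{2}\right)-H_N\left(\beta-\tfrac{i\pi}{2}\right).$$ The contour $\mathcal{C}_0$ is the union of the line $\mathbb{R}-\frac{i\pi}{2}$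 oriented from right to left and the line $\mathbb{R}-\frac{5i\pi}{2}$ oriented from left to right. $\widehat{g}(\omega):=\int_{-\infty}^{+\infty}e^{i\omega s}e^{-i\omega_0s}f(s)\,ds$ for $\omega\in\mathbb{C}^+$. The Fourier–Laplace transform of a tempered distribution supported in $[0,\infty)$ is the holomorphic extension to $\mathbb{C}^+$ of its Fourier transform, normalized as $\widehat{u}(\omega)=\int e^{i\omega t}u(t)\,dt$; $F^{-1}_{\omega\to t}$ is the inverse of this transform in $\mathcal{S}'$ of distributions supported in $[0,\infty)$. *)

(* Defs.v *)
From HB Require Import structures.
From mathcomp Require Import all_boot all_order all_algebra.
From mathcomp Require Import all_classical all_reals all_analysis.
From mathcomp Require Import complex.

Set Implicit Arguments.
Unset Strict Implicit.
Unset Printing Implicit Defensive.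

Import Order.TTheory GRing.Theory Num.Theory.
Import numFieldNormedType.Exports.

Local Open Scope classical_set_scope.
Local Open Scope ring_scope.
Local Open Scope complex_scope.

Notation ReC := (@complex.Re _).
Notation ImC := (@complex.Im _).

Section ComplexFunctions.
Variable R : realType.
Local Notation C := R[i].

(* [`|z|] lives in [R[i]]; this is the same modulus as an element of [R]. *)
Definition cabs (z : C) : R := ReC `|z|.

Definition cexp (z : C) : C :=
  (expR (ReC z))%:C * (cos (ImC z) +i* sin (ImC z)).

Definition csinh (z : C) : C := (cexp z - cexp (- z)) / 2.

Definition ccosh (z : C) : C := (cexp z + cexp (- z)) / 2.

Definition ccoth (z : C) : C := ccosh z / csinh z.

Definition rcosh (x : R) : R := (expR x + expR (- x)) / 2.

End ComplexFunctions.

Section ComplexIntegral.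
Variable R : realType.
Local Notation C := R[i].
Local Notation mu := (@lebesgue_measure R).

Definition cintegrable (g : R -> C) : Prop :=
  mu.-integrable setT (fun x => (ReC (g x))%:E) /\
  mu.-integrable setT (fun x => (ImC (g x))%:E).

Definition cint (g : R -> C) : C :=
  (\int[mu]_x ReC (g x))%R +i* (\int[mu]_x ImC (g x))%R.

(* Integral of [F] along the line [R + i c], oriented from left to right. *)
Definition line_int (c : R) (F : C -> C) : C := cint (fun x => F (x +i* c)).

(* The contour C_0: the line [R - i pi/2] from right to left, together with
   the line [R - 5 i pi/2] from left to right. *)
Definition C0_int (F : C -> C) : C :=
  line_int (- (5 * pi / 2)) F - line_int (- (pi / 2)) F.

End ComplexIntegral.

Section TemperedDistributions.
Variable R : realType.
Local Notation C := R[i].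

Definition smooth (g : R -> C) : Prop :=
  forall (n : nat) (x : R),
    derivable (derive1n n (fun t => ReC (g t))) x 1 /\
    derivable (derive1n n (fun t => ImC (g t))) x 1.

Definition cderiven (n : nat) (g : R -> C) (x : R) : C :=
  (derive1n n (fun t => ReC (g t)) x) +i* (derive1n n (fun t => ImC (g t)) x).

Definition schwartz (g : R -> C) : Prop :=
  smooth g /\
  forall j k : nat, exists M : R,
    forall x : R, `|x| ^+ j * cabs (cderiven k g x) <= M.

(* A distribution is a functional on functions [R -> C]; only its values on
   Schwartz functions are meaningful. *)
Definition functional := (R -> C) -> C.

(* The last clause says |T g| <= A * max_{j, k <= N} sup_x |x|^j |g^(k)(x)|,
   the suprema being described by their upper bounds M. *)
Definition tempered (T : functional) : Prop :=
  (forall (a : C) (g h : R -> C), schwartz g -> schwartz h ->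
     T (fun x => a * g x + h x) = a * T g + T h) /\
  exists (N : nat) (A : R),
    forall (g : R -> C) (M : R), schwartz g ->
      (forall j k : nat, (j <= N)%N -> (k <= N)%N ->
         forall x : R, `|x| ^+ j * cabs (cderiven k g x) <= M) ->
      cabs (T g) <= A * M.

(* supp T is contained in [0, +oo[: T vanishes on the test functions whose
   support is a compact subset of ]-oo, 0[. *)
Definition supported_nonneg (T : functional) : Prop :=
  forall (g : R -> C) (a b : R), smooth g -> b < 0 ->
    (forall x : R, ~~ (a <= x <= b) -> g x = 0) -> T g = 0.

Definition fourier (g : R -> C) (t : R) : C :=
  cint (fun x => cexp ((x * t)*i) * g x).

Definition fourier_dist (T : functional) : functional :=
  fun g => T (fourier g).

Definition upper_half_plane : set C := [set w | 0 < ImC w].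

(* [F], restricted to the upper half-plane, is a holomorphic extension of the
   distribution [S] on the real line: it is holomorphic there and its boundary
   value F(. + i0), taken in the space of tempered distributions, is [S]. *)
Definition holomorphic_extension (S : functional) (F : C -> C) : Prop :=
  (forall w : C, upper_half_plane w ->
     derivable (F : C^o -> C^o) w 1) /\
  forall g : R -> C, schwartz g ->
    (forall e : R, 0 < e -> cintegrable (fun x => F (x +i* e) * g x)) /\
    (fun e : R => (cint (fun x => F (x +i* e) * g x) : C^o)) @ 0^'+
      --> (S g : C^o).

(* [T] is the inverse Fourier-Laplace transform of [F]: [T] is a tempered
   distribution supported in [0, +oo[ whose Fourier-Laplace transform is [F]
   on the upper half-plane. *)
Definition inverse_FL (F : C -> C) (T : functional) : Prop :=
  [/\ tempered T, supported_nonneg T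
    & holomorphic_extension (fourier_dist T) F].

(* The distribution [T] is the continuous function [u]; continuity makes the
   value [u t] at every point [t] determined by [T]. *)
Definition is_function (T : functional) (u : R -> C) : Prop :=
  continuous (u : R -> C^o) /\
  forall g : R -> C, schwartz g ->
    cintegrable (fun t => u t * g t) /\ T g = cint (fun t => u t * g t).

End TemperedDistributions.

Section Wedge.
Variable R : realType.
Local Notation C := R[i].
Variables (omega0 phi alpha : R) (f : R -> C).

Definition Phi : R := 2 * pi - phi.

Definition q : R := pi / (2 * Phi).

Definition theta1 : R := 2 * phi - alpha.

Definition theta2 : R := 2 * pi - alpha.

Definition Theta : set R :=
  [set th | phi <= th <= 2 * pi /\ th <> theta1 /\ th <> theta2].

Definition H_N (b : C) : C :=
  ccoth (q%:C * (b + (pi / 2)*i - alpha *i)) +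
  ccoth (q%:C * (b - (3 * pi / 2)*i + alpha *i)).

Definition Z_N (b : C) : C :=
  H_N (b - (5 * pi / 2)*i) - H_N (b - (pi / 2)*i).

Definition g_hat (w : C) : C :=
  cint (fun s => cexp (1 *i * w * s%:C) * cexp ((- (omega0 * s))*i) * f s).

Definition u_d_hat (rho th : R) (w : C) : C :=
  1 *i / (4 * Phi)%:C * g_hat w *
  C0_int (fun b => cexp (- (rho%:C * w * csinh b)) * H_N (b + th *i)).

Definition u_d_formula (rho th t : R) : C :=
  1 *i * cexp ((- (omega0 * t))*i) / (4 * Phi)%:C *
  cint (fun b => cexp ((omega0 * rho * rcosh b)*i) *
                 Z_N (b%:C + th *i) * f (t - rho * rcosh b)).

End Wedge.

(* Main.v *)
Require Import Defs.
From HB Require Import structures.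
From mathcomp Require Import all_boot all_order all_algebra.
From mathcomp Require Import all_classical all_reals all_analysis.
From mathcomp Require Import measurable_realfun complex ring lra.

Set Implicit Arguments.
Unset Strict Implicit.
Unset Printing Implicit Defensive.

Import Order.TTheory GRing.Theory Num.Theory.
Import numFieldNormedType.Exports.

Local Open Scope classical_set_scope.
Local Open Scope ring_scope.
Local Open Scope complex_scope.

(** On both lines of the contour [- rho w sinh b] equals [i w rho cosh x], so
    the contour integral is the integral over the real line of
    [exp (i w rho cosh x) Z_N (x + i theta)].  Multiplying by [g_hat w], shifting
    its variable by [rho cosh x] and exchanging the integrals shows that
    [u_d_hat] is the Laplace integral of [u_d_formula], which is continuous,
    vanishes for [t <= 0] and is [O(t)].  For any such [u] the boundary value of
    the Laplace integral is the Fourier transform of [u], because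
    [|1 - exp (- e t)| <= e t]; since the Fourier transform maps the Schwartz
    space onto itself, no other tempered distribution has this boundary value.
    That [Z_N] is bounded is enough for [u_d_formula = O(t)], as
    [f (t - rho cosh x)] vanishes unless [1 + x^2 <= 8 t / rho]. *)

(** * Complex modulus and exponential *)

(** The estimates carry explicit rates, so that a limit is taken under an integral only for the
    continuity of the amplitude. One integrable weight, stable under translation, dominates the
    integrands of one variable, and its tensor square those of two; this gives integrability, Fubini
    and translation invariance. Derivatives under the integral, boundary values and the Gaussian
    limit come from remainders of order [h^2] or [e]. The poles of [H_N] restrict theta. On each
    line of the contour the arguments of coth have constant imaginary parts, and
    [|coth (x + i y)| <= 1 / |sin y|]. For [phi <= theta <= 2 pi] some [sin y] vanishes exactly at
    [theta2] on the upper line and at [theta1] on the lower one. That the Fourier transform maps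
    onto the Schwartz space is the inversion formula, obtained by Gaussian regularization. The
    transform of a Gaussian is found from its first-order differential equation, normalized by the
    mass 1 of the normal density. *)

Section ComplexBasics.
Variable R : realType.
Local Notation C := R[i].
Implicit Types (z w : C) (x y : R).

Lemma cabsE z : cabs z = Num.sqrt (ReC z ^+ 2 + ImC z ^+ 2).
Proof. by rewrite /cabs normc_def. Qed.

Lemma cabsC z : (cabs z)%:C = `|z|.
Proof. by rewrite cabsE -normc_def. Qed.

Lemma cabs_ge0 z : 0 <= cabs z.
Proof. by rewrite cabsE sqrtr_ge0. Qed.

Lemma cabs0 : cabs (0 : C) = 0.
Proof. by apply: complexI; rewrite cabsC normr0. Qed.

Lemma cabs1 : cabs (1 : C) = 1.
Proof. by apply: complexI; rewrite cabsC normr1. Qed.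

Lemma cabsM z w : cabs (z * w) = cabs z * cabs w.
Proof. by apply: complexI; rewrite rmorphM /= !cabsC normrM. Qed.

Lemma cabsV z : cabs z^-1 = (cabs z)^-1.
Proof. by apply: complexI; rewrite fmorphV /= !cabsC normfV. Qed.

Lemma cabsN z : cabs (- z) = cabs z.
Proof. by apply: complexI; rewrite !cabsC normrN. Qed.

Lemma cabsD z w : cabs (z + w) <= cabs z + cabs w.
Proof. by rewrite -lecR rmorphD /= !cabsC ler_normD. Qed.

Lemma cabsB z w : cabs (z - w) <= cabs z + cabs w.
Proof. by rewrite -(cabsN w) cabsD. Qed.

Lemma cabsBC z w : cabs (z - w) = cabs (w - z).
Proof. by rewrite -cabsN opprB. Qed.

Lemma cabs_real x : cabs (x%:C) = `|x|.
Proof. by rewrite cabsE /= expr0n addr0 sqrtr_sqr. Qed.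

Lemma cabs_i x : cabs (x *i) = `|x|.
Proof. by rewrite cabsE /= expr0n add0r sqrtr_sqr. Qed.

Lemma cabs_eq0 z : (cabs z == 0) = (z == 0).
Proof. by rewrite -(inj_eq (@complexI R)) cabsC normr_eq0. Qed.

Lemma cabs_gt0 z : (0 < cabs z) = (z != 0).
Proof. by rewrite lt_def cabs_eq0 cabs_ge0 andbT. Qed.

Lemma Re_le_cabs z : `|ReC z| <= cabs z.
Proof. by rewrite cabsE -sqrtr_sqr ler_wsqrtr // lerDl sqr_ge0. Qed.

Lemma Im_le_cabs z : `|ImC z| <= cabs z.
Proof. by rewrite cabsE -sqrtr_sqr ler_wsqrtr // lerDr sqr_ge0. Qed.

Lemma cabs_le z : cabs z <= `|ReC z| + `|ImC z|.
Proof.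
rewrite [z in cabs z](_ : z = (ReC z)%:C + (ImC z)*i); last first.
  by case: z => a b; simpc.
by apply: le_trans (cabsD _ _) _; rewrite cabs_real cabs_i.
Qed.

Lemma sqr_cabs z : cabs z ^+ 2 = ReC z ^+ 2 + ImC z ^+ 2.
Proof. by rewrite cabsE sqr_sqrtr // addr_ge0 ?sqr_ge0. Qed.

Lemma ReCD z w : ReC (z + w) = ReC z + ReC w.
Proof. by case: z; case: w. Qed.
Lemma ImCD z w : ImC (z + w) = ImC z + ImC w.
Proof. by case: z; case: w. Qed.
Lemma ReCN z : ReC (- z) = - ReC z. Proof. by case: z. Qed.
Lemma ImCN z : ImC (- z) = - ImC z. Proof. by case: z. Qed.
Lemma ReCM z w : ReC (z * w) = ReC z * ReC w - ImC z * ImC w.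
Proof. by case: z; case: w. Qed.
Lemma ImCM z w : ImC (z * w) = ReC z * ImC w + ImC z * ReC w.
Proof. by case: z; case: w. Qed.

Definition ReImCE := (ReCD, ImCD, ReCN, ImCN, ReCM, ImCM).

Lemma complex_eq z w : ReC z = ReC w -> ImC z = ImC w -> z = w.
Proof. by case: z => a b; case: w => c d /= -> ->. Qed.

Lemma cexp0 : cexp (0 : C) = 1.
Proof. by rewrite /cexp /= expR0 cos0 sin0 mul1r. Qed.

Lemma cexpD z w : cexp (z + w) = cexp z * cexp w.
Proof.
by apply: complex_eq; rewrite /cexp !ReImCE /= expRD cosD sinD; ring.
Qed.

Lemma cabs_cexp z : cabs (cexp z) = expR (ReC z).
Proof.
rewrite /cexp cabsM cabs_real ger0_norm ?expR_ge0 // cabsE /=.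
by rewrite cos2Dsin2 sqrtr1 mulr1.
Qed.

(** The endpoints come in either order, so that increments of both signs are covered; this is why
    the intermediate point is located by its distance to [a]. *)
Lemma mean_value (f f' : R -> R) (a b : R) :
  (forall x, is_derive x 1 f (f' x)) ->
  exists2 c, `|c - a| <= `|b - a| & f b - f a = f' c * (b - a).
Proof.
move=> df.
have cf : continuous f.
  by move=> x; apply/differentiable_continuous/derivable1_diffP; case: (df x).
have [ab|ba] := leP a b.
  have [|c cab ->] := MVT_segment ab (fun x _ => df x).
    exact: continuous_subspaceT.
  exists c => //; move: cab; rewrite in_itv /= => /andP[ac cb].
  by rewrite !ger0_norm ?subr_ge0 // lerD2r.
have [|c cab E] := MVT_segment (ltW ba) (fun x _ => df x).
  exact: continuous_subspaceT.
exists c; last by rewrite -[LHS]opprB E -mulrN opprB.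
move: cab; rewrite in_itv /= => /andP[ac cb].
by rewrite !ler0_norm ?subr_le0 ?(ltW ba) // lerN2 lerD2r.
Qed.

Lemma sin_le_norm x : `|sin x| <= `|x|.
Proof.
have [c _] := @mean_value (@sin R) (@cos R) 0 x (fun y => is_derive_sin y).
rewrite sin0 !subr0 => ->; rewrite normrM ler_piMl //.
exact: cos_max.
Qed.

Lemma cosB1_le x : `|cos x - 1| <= x ^+ 2.
Proof.
have [c] := @mean_value (@cos R) (fun x => - sin x) 0 x (fun y => is_derive_cos y).
rewrite cos0 !subr0 => cx ->; rewrite normrM normrN -real_normK ?num_real //.
by rewrite expr2 ler_wpM2r // (le_trans (sin_le_norm _)).
Qed.

Lemma cosB1_le_norm x : `|cos x - 1| <= `|x|.
Proof.
have [c _] := @mean_value (@cos R) (fun x => - sin x) 0 x (fun y => is_derive_cos y).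
rewrite cos0 !subr0 => ->; rewrite normrM normrN ler_piMl //.
exact: sin_max.
Qed.

Lemma sinBid_le x : `|sin x - x| <= x ^+ 2.
Proof.
have D y : is_derive y 1 (fun t : R => sin t - t) (cos y - 1).
  by apply: is_deriveB.
have [c] := @mean_value (fun t : R => sin t - t) (fun x => cos x - 1) 0 x D.
rewrite sin0 !subr0 => cx ->; rewrite normrM -real_normK ?num_real //.
by rewrite expr2 ler_wpM2r // (le_trans (cosB1_le_norm _)).
Qed.

(** This is [1 + y <= expR y] at [y = - x], multiplied by [expR x]. *)
Lemma expRB1_le x : expR x - 1 <= x * expR x.
Proof.
have := expR_ge1Dx (- x); rewrite -(ler_pM2r (expR_gt0 x)) -expRD addNr expR0.
by rewrite mulrDl mul1r mulNr; lra.
Qed.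

Lemma expRB1_norm x : `|expR x - 1| <= `|x| * expR `|x|.
Proof.
have h1 := expRB1_le x; have h2 := expR_ge1Dx x.
have [x0|x0] := leP 0 x.
  by rewrite (ger0_norm x0) ger0_norm //; lra.
have e1 : 1 <= expR (- x) by rewrite -expR0 ler_expR; lra.
have e2 : expR x <= 1 by rewrite -expR0 ler_expR; lra.
rewrite (ltr0_norm x0) ler0_norm; nra.
Qed.

Lemma expRB1Bid_norm x : `|expR x - 1 - x| <= x ^+ 2 * expR `|x|.
Proof.
have h1 := expRB1_le x; have h2 := expR_ge1Dx x.
have h3 := expRB1_norm x.
rewrite ger0_norm; last lra.
apply: (@le_trans _ _ (`|x| * `|expR x - 1|)).
  rewrite -normrM; apply: le_trans (ler_norm _).
  by rewrite mulrBr mulr1 lerD2r.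
by rewrite -real_normK ?num_real // expr2 -mulrA ler_wpM2l.
Qed.

(** Only the real part enters the exponential. For the Fourier kernel [z] is imaginary and the bound
    is purely quadratic; for the Laplace kernel the loss [expR |Re z|] is absorbed by the decay of
    the kernel. *)
Lemma cexpB1Bid_le z :
  cabs (cexp z - 1 - z) <= 4 * cabs z ^+ 2 * expR `|ReC z|.
Proof.
case: z => a b.
apply: le_trans (cabs_le _) _; rewrite sqr_cabs /cexp !ReImCE /=.
have h1 := expRB1_norm a; have h2 := expRB1Bid_norm a.
have h3 := cosB1_le b; have h4 := sinBid_le b.
have e1 : expR a <= expR `|a| by rewrite ler_expR ler_norm.
have e0 := expR_ge0 a; have e0' := expR_ge0 `|a|.
rewrite !mul0r subr0 addr0 oppr0 addr0.
rewrite (_ : expR a * cos b - 1 - a = (expR a - 1 - a) + expR a * (cos b - 1)); last by ring.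
rewrite (_ : expR a * sin b - b = expR a * (sin b - b) + b * (expR a - 1)); last by ring.
have k1 : `|expR a * (cos b - 1)| <= expR `|a| * b ^+ 2.
  by rewrite normrM (ger0_norm e0) ler_pM.
have k2 : `|expR a * (sin b - b)| <= expR `|a| * b ^+ 2.
  by rewrite normrM (ger0_norm e0) ler_pM.
have k3 : `|b * (expR a - 1)| <= `|b| * (`|a| * expR `|a|).
  by rewrite normrM ler_wpM2l.
have k4 : `|b| * `|a| <= a ^+ 2 + b ^+ 2.
  by rewrite -(real_normK (num_real a)) -(real_normK (num_real b)); nra.
have k5 : `|b| * (`|a| * expR `|a|) <= (a ^+ 2 + b ^+ 2) * expR `|a|.
  by rewrite mulrA ler_wpM2r.
apply: le_trans (lerD (ler_normD _ _) (ler_normD _ _)) _.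
nra.
Qed.

End ComplexBasics.
(** * Integrals dominated by the weight 1 / (1 + x^2) *)

Section DominatedReal.
Variable R : realType.
Local Notation mu := (@lebesgue_measure R).

(** An integrable majorant that a translation changes by a constant factor only; it serves for
    almost all integrals below. *)
Definition weight (x : R) : R := (1 + x ^+ 2)^-1.

Lemma weight_den_gt0 (x : R) : 0 < 1 + x ^+ 2.
Proof. by rewrite ltr_pwDl // sqr_ge0. Qed.

Lemma weight_gt0 (x : R) : 0 < weight x.
Proof. by rewrite invr_gt0 weight_den_gt0. Qed.

Lemma weight_ge0 (x : R) : 0 <= weight x. Proof. exact/ltW/weight_gt0. Qed.

Lemma weight_continuous : continuous weight.
Proof. exact: continuous_oneDsqrV. Qed.

Lemma le_weight (x a K : R) : a * (1 + x ^+ 2) <= K -> a <= K * weight x.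
Proof. by move=> h; rewrite ler_pdivlMr ?weight_den_gt0. Qed.

Lemma weightN (x : R) : weight (- x) = weight x.
Proof. by rewrite /weight sqrrN. Qed.

(** Peetre's inequality: with [y = x + a], the difference [2 (1 + a^2) (1 + y^2) - (1 + x^2)] equals
    [1 + (x + 2 a)^2 + 2 (a y)^2]. *)
Lemma weight_shift (x a : R) : weight (x + a) <= 2 * (1 + a ^+ 2) * weight x.
Proof.
apply: le_weight; rewrite ler_pdivrMl ?weight_den_gt0 //.
have h1 := sqr_ge0 (x + 2 * a); have h2 := sqr_ge0 (a * (x + a)).
by rewrite -subr_ge0; move: h1 h2; rewrite !expr2; nra.
Qed.

Lemma weight_near (x y : R) : `|y - x| <= 1 -> weight y <= 4 * weight x.
Proof.
move=> yx; rewrite (_ : y = x + (y - x)); last by ring.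
apply: le_trans (weight_shift _ _) _; rewrite ler_wpM2r ?weight_ge0 //.
have : (y - x) ^+ 2 <= 1 by rewrite -real_normK ?num_real // expr_le1.
lra.
Qed.

Lemma integrable_weight : mu.-integrable setT (EFin \o weight).
Proof.
apply/integrableP; split.
  apply/measurable_EFinP; apply: continuous_measurable_fun.
  exact: weight_continuous.
under eq_integral do rewrite /= ger0_norm ?weight_ge0 //.
rewrite ge0_symfun_integralT; first 1 last.
- exact: weight_ge0.
- exact: weight_continuous.
- by move=> x /=; rewrite weightN.
rewrite -set_itvE integral0y_oneDsqr -EFinM; exact: ltry.
Qed.

Definition weight_mass : R := (\int[mu]_x weight x)%R.

Lemma weight_mass_ge0 : 0 <= weight_mass.
Proof. by apply: Rintegral_ge0 => x _; exact: weight_ge0. Qed.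

Lemma integrable_cst_weight (K : R) :
  mu.-integrable setT (EFin \o (fun x => K * weight x)).
Proof. exact: (integrableZl measurableT K integrable_weight). Qed.

Lemma weighted_integrable (g : R -> R) (K : R) : measurable_fun setT g ->
  (forall x, `|g x| <= K * weight x) -> mu.-integrable setT (EFin \o g).
Proof.
move=> mg gK; apply: le_integrable (integrable_cst_weight K) => //.
  exact/measurable_EFinP.
move=> x _ /=; rewrite lee_fin; apply: le_trans (gK x) _; exact: ler_norm.
Qed.

Lemma weighted_Rintegral_le (g : R -> R) (K : R) : measurable_fun setT g ->
  (forall x, `|g x| <= K * weight x) -> `|\int[mu]_x g x| <= K * weight_mass.
Proof.
move=> mg gK; have ig := weighted_integrable mg gK.
apply: le_trans (le_normr_Rintegral _ ig) _ => //.
rewrite -RintegralZl //; last exact: integrable_weight.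
apply: le_Rintegral => //; last exact: integrable_cst_weight.
exact: (integrable_norm ig).
Qed.

Lemma weighted_prod_integrable (G : R * R -> R) (K : R) :
  measurable_fun setT G ->
  (forall x y, `|G (x, y)| <= K * weight x * weight y) ->
  (mu \x mu)%E.-integrable setT (EFin \o G).
Proof.
move=> mG GK.
have K0 : 0 <= K.
  have := le_trans (normr_ge0 _) (GK 0 0).
  by rewrite /weight expr0n addr0 invr1 !mulr1.
apply/integrable12ltyP; first exact/measurable_EFinP.
(* By Tonelli it is enough that the inner integral of [|G (x, y)|] over [y] is at most
   [K * weight_mass * weight x]. *)
apply: (@le_lt_trans _ _ (\int[mu]_x (K * weight_mass * weight x)%:E)%E); last first.
  have /integrableP[_] := integrable_cst_weight (K * weight_mass).
  apply: le_lt_trans; apply: ge0_le_integral => //.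
  - by move=> x _; rewrite lee_fin !mulr_ge0 ?weight_ge0 ?weight_mass_ge0.
  - by have /integrableP[] := integrable_cst_weight (K * weight_mass).
  - apply: measurableT_comp => //.
    by have /integrableP[] := integrable_cst_weight (K * weight_mass).
  - by move=> x _; rewrite lee_fin ler_norm.
have mGx x : measurable_fun setT (fun y => G (x, y)).
  exact: measurableT_comp mG (pair1_measurable x).
apply: ge0_le_integral => //.
- by move=> x _; apply: integral_ge0.
- apply: (@measurable_fun_fubini_tonelli_F _ _ _ _ _ mu
    (fun xy => `|(G xy)%:E|%E)) => //.
  by apply: measurableT_comp => //; exact/measurable_EFinP.
- by have /integrableP[] := integrable_cst_weight (K * weight_mass).
move=> x _.
have mn : measurable_fun setT (fun y => `|G (x, y)|) by exact: measurableT_comp.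
have bn y : `| `|G (x, y)| | <= K * weight x * weight y by rewrite normr_id.
have := weighted_Rintegral_le mn bn.
have ix := weighted_integrable mn bn.
rewrite ger0_norm ?Rintegral_ge0 // => H.
rewrite -[leLHS]fineK; last exact: integrable_fin_num ix.
by rewrite lee_fin mulrAC.
Qed.

Lemma weighted_Fubini (G : R * R -> R) (K : R) : measurable_fun setT G ->
  (forall x y, `|G (x, y)| <= K * weight x * weight y) ->
  \int[mu]_x (\int[mu]_y G (x, y))%R = \int[mu]_y (\int[mu]_x G (x, y))%R.
Proof.
move=> mG GK; have iG := weighted_prod_integrable mG GK.
have i1 x : mu.-integrable setT (EFin \o (fun y => G (x, y))).
  apply: (weighted_integrable (K := K * weight x)) => //.
  exact: measurableT_comp mG (pair1_measurable x).
have i2 y : mu.-integrable setT (EFin \o (fun x => G (x, y))).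
  apply: (weighted_integrable (K := K * weight y)) => [|x].
    exact: measurableT_comp mG (pair2_measurable y).
  by rewrite mulrAC.
rewrite /Rintegral.
under eq_integral => x _ do rewrite fineK ?(integrable_fin_num _ (i1 x)) //.
under [in RHS]eq_integral => y _ do rewrite fineK ?(integrable_fin_num _ (i2 y)) //.
by rewrite (Fubini iG).
Qed.

Lemma weighted_measurable_Rintegral (G : R * R -> R) (K : R) :
  measurable_fun setT G ->
  (forall x y, `|G (x, y)| <= K * weight x * weight y) ->
  measurable_fun setT (fun x => \int[mu]_y G (x, y))%R.
Proof.
move=> mG GK; have iG := weighted_prod_integrable mG GK.
exact: measurableT_comp (fine_measurable measurableT) (measurable_fubini_F iG).
Qed.

Lemma Rintegral_shift_ge0 (g : R -> R) (a : R) : continuous g ->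
  (forall x, 0 <= g x) -> \int[mu]_x g (x + a) = \int[mu]_x g x.
Proof.
move=> cg g0; rewrite /Rintegral.
have dF (x : R) : is_derive x 1 (fun y : R => y + a) 1.
  by apply: is_derive_eq; rewrite addr0.
have dF1 : derive1 (fun y : R => y + a) = cst 1.
  by apply/funext => x; rewrite derive1E; apply: derive_val.
rewrite [in RHS](@increasing_ge0_integration_by_substitutionT _ (fun y => y + a) g) //.
- by rewrite dF1; congr fine; apply: eq_integral => x _ /=; rewrite mulr1.
- by move=> x y; rewrite ltrD2r.
- by rewrite dF1 => x; exact: cvg_cst.
- by rewrite dF1; exact: is_cvg_cst.
- by rewrite dF1; exact: is_cvg_cst.
- exact: cvg_addrr_Ny.
- exact: cvg_addrr.
Qed.

(** Both [g + K * weight] and [K * weight] are nonnegative, so the shift rule for nonnegative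
    integrands applies to each; subtraction leaves [g]. *)
Lemma weighted_shift (g : R -> R) (K a : R) : continuous g ->
  (forall x, `|g x| <= K * weight x) -> \int[mu]_x g (x + a) = \int[mu]_x g x.
Proof.
move=> cg gK.
have K0 : 0 <= K.
  by have := le_trans (normr_ge0 _) (gK 0); rewrite pmulr_lge0 ?weight_gt0.
have cw : continuous (fun x => K * weight x).
  by move=> x; apply: cvgM; [exact: cvg_cst|exact: weight_continuous].
have ca : continuous (fun x : R => x + a).
  by move=> x; apply: cvgD; [exact: cvg_id|exact: cvg_cst].
have ig := weighted_integrable (continuous_measurable_fun cg) gK.
have iga : mu.-integrable setT (EFin \o (fun x => g (x + a))).
  apply: (weighted_integrable (K := K * (2 * (1 + a ^+ 2)))).
    by apply: continuous_measurable_fun => x; apply: continuous_comp; [exact: ca|exact: cg].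
  move=> x; apply: le_trans (gK _) _.
  by rewrite -mulrA ler_wpM2l // weight_shift.
have iwa : mu.-integrable setT (EFin \o (fun x => K * weight (x + a))).
  apply: (weighted_integrable (K := K * (2 * (1 + a ^+ 2)))).
    apply: continuous_measurable_fun => x.
    exact: (@continuous_comp _ _ _ (fun y => y + a) (fun y => K * weight y) x (ca x) (cw _)).
  move=> x; rewrite ger0_norm ?mulr_ge0 ?weight_ge0 //.
  by rewrite -mulrA ler_wpM2l // weight_shift.
have := @Rintegral_shift_ge0 (fun x => g x + K * weight x) a.
rewrite !RintegralD //; last exact: integrable_cst_weight.
rewrite (@Rintegral_shift_ge0 (fun x => K * weight x) a) //; last first.
  by move=> x; rewrite mulr_ge0 ?weight_ge0.
have cgw : continuous (fun x => g x + K * weight x).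
  by move=> x; apply: cvgD; [exact: cg|exact: cw].
have gw0 x : 0 <= g x + K * weight x.
  by have := gK x; rewrite ler_norml => /andP[]; lra.
by move=> /(_ cgw gw0); exact: addIr.
Qed.

End DominatedReal.
(** * Complex-valued integrands *)

Section ComplexMeasurable.
Variable R : realType.
Local Notation C := R[i].

(** Componentwise, to match [cintegrable] and [cint]; no sigma-algebra on [R[i]] is involved. *)
Definition cmeasurable d (T : measurableType d) (g : T -> C) :=
  measurable_fun setT (fun x => ReC (g x)) /\
  measurable_fun setT (fun x => ImC (g x)).

Definition ccontinuous (g : R -> C) :=
  continuous (fun x => ReC (g x)) /\ continuous (fun x => ImC (g x)).

Section Closure.
Context d (T : measurableType d).
Implicit Types g h : T -> C.

Lemma cmeasurable_cst (c : C) : cmeasurable (fun _ : T => c).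
Proof. by split; exact: measurable_cst. Qed.

Lemma cmeasurableD g h : cmeasurable g -> cmeasurable h ->
  cmeasurable (fun x => g x + h x).
Proof.
move=> [g1 g2] [h1 h2]; split.
  under eq_fun do rewrite ReCD; exact: measurable_funD.
under eq_fun do rewrite ImCD; exact: measurable_funD.
Qed.

Lemma cmeasurableN g : cmeasurable g -> cmeasurable (fun x => - g x).
Proof.
move=> [g1 g2]; split.
  under eq_fun do rewrite ReCN; exact: measurableT_comp.
under eq_fun do rewrite ImCN; exact: measurableT_comp.
Qed.

Lemma cmeasurableB g h : cmeasurable g -> cmeasurable h ->
  cmeasurable (fun x => g x - h x).
Proof. by move=> mg mh; apply: cmeasurableD => //; exact: cmeasurableN. Qed.

Lemma cmeasurableM g h : cmeasurable g -> cmeasurable h ->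
  cmeasurable (fun x => g x * h x).
Proof.
move=> [g1 g2] [h1 h2]; split.
  under eq_fun do rewrite ReCM.
  by apply: measurable_funB; exact: measurable_funM.
under eq_fun do rewrite ImCM.
by apply: measurable_funD; exact: measurable_funM.
Qed.

Lemma cmeasurable_real (u : T -> R) : measurable_fun setT u ->
  cmeasurable (fun x => (u x)%:C).
Proof. by move=> mu; split => //=; exact: measurable_cst. Qed.

Lemma cmeasurable_i (u : T -> R) : measurable_fun setT u ->
  cmeasurable (fun x => (u x)*i).
Proof. by move=> mu; split => //=; exact: measurable_cst. Qed.

Lemma cmeasurable_cexp g : cmeasurable g -> cmeasurable (fun x => cexp (g x)).
Proof.
move=> [g1 g2]; rewrite /cexp.
apply: cmeasurableM.
  by apply: cmeasurable_real; exact: measurableT_comp.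
split => /=; apply: measurableT_comp => //; apply: continuous_measurable_fun.
  exact: continuous_cos.
exact: continuous_sin.
Qed.

End Closure.

Lemma cmeasurable_comp d d' (T : measurableType d) (U : measurableType d')
    (g : U -> C) (h : T -> U) :
  cmeasurable g -> measurable_fun setT h -> cmeasurable (fun x => g (h x)).
Proof.
by move=> [g1 g2] mh; split; [exact: measurableT_comp g1 mh|exact: measurableT_comp g2 mh].
Qed.

Lemma ccontinuous_measurable (g : R -> C) : ccontinuous g -> cmeasurable g.
Proof. by move=> [g1 g2]; split; exact: continuous_measurable_fun. Qed.

Implicit Types g h : R -> C.

Lemma ccontinuous_cst (c : C) : ccontinuous (fun=> c).
Proof. by split=> x; exact: cvg_cst. Qed.

Lemma ccontinuousD g h : ccontinuous g -> ccontinuous h ->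
  ccontinuous (fun x => g x + h x).
Proof.
move=> [g1 g2] [h1 h2]; split => x.
  by under eq_fun do rewrite ReCD; apply: cvgD; [exact: g1|exact: h1].
by under eq_fun do rewrite ImCD; apply: cvgD; [exact: g2|exact: h2].
Qed.

Lemma ccontinuousN g : ccontinuous g -> ccontinuous (fun x => - g x).
Proof.
move=> [g1 g2]; split => x.
  by under eq_fun do rewrite ReCN; apply: cvgN; exact: g1.
by under eq_fun do rewrite ImCN; apply: cvgN; exact: g2.
Qed.

Lemma ccontinuousB g h : ccontinuous g -> ccontinuous h ->
  ccontinuous (fun x => g x - h x).
Proof. by move=> mg mh; apply: ccontinuousD => //; exact: ccontinuousN. Qed.

Lemma ccontinuousM g h : ccontinuous g -> ccontinuous h ->
  ccontinuous (fun x => g x * h x).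
Proof.
move=> [g1 g2] [h1 h2]; split => x.
  by under eq_fun do rewrite ReCM; apply: cvgB; apply: cvgM;
    [exact: g1|exact: h1|exact: g2|exact: h2].
by under eq_fun do rewrite ImCM; apply: cvgD; apply: cvgM;
    [exact: g1|exact: h2|exact: g2|exact: h1].
Qed.

Lemma ccontinuous_real (u : R -> R) : continuous u ->
  ccontinuous (fun x => (u x)%:C).
Proof. by move=> mu; split => //= x; exact: cvg_cst. Qed.

Lemma ccontinuous_i (u : R -> R) : continuous u ->
  ccontinuous (fun x => (u x)*i).
Proof. by move=> mu; split => //= x; exact: cvg_cst. Qed.

Lemma ccontinuous_comp g (u : R -> R) : ccontinuous g -> continuous u ->
  ccontinuous (fun x => g (u x)).
Proof.
move=> [g1 g2] cu; split => x.
  exact: (@continuous_comp _ _ _ u (fun y => ReC (g y)) x (cu x) (g1 _)).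
exact: (@continuous_comp _ _ _ u (fun y => ImC (g y)) x (cu x) (g2 _)).
Qed.

Lemma ccontinuous_cexp g : ccontinuous g -> ccontinuous (fun x => cexp (g x)).
Proof.
move=> [g1 g2]; rewrite /cexp.
apply: ccontinuousM.
  apply: ccontinuous_real => x.
  exact: (@continuous_comp _ _ _ (fun y => ReC (g y)) expR x (g1 x) (@continuous_expR R _)).
split => /= x.
  exact: (@continuous_comp _ _ _ (fun y => ImC (g y)) cos x (g2 x) (@continuous_cos R _)).
exact: (@continuous_comp _ _ _ (fun y => ImC (g y)) sin x (g2 x) (@continuous_sin R _)).
Qed.

Lemma ccontinuousV g : (forall x, g x != 0) -> ccontinuous g ->
  ccontinuous (fun x => (g x)^-1).
Proof.
move=> g0 cg; have [g1 g2] := cg.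
have E x : (g x)^-1 = ((ReC (g x) ^+ 2 + ImC (g x) ^+ 2)^-1)%:C * (ReC (g x) -i* ImC (g x)).
  case: (g x) => a b; apply: complex_eq; rewrite !ReImCE /=; ring.
have N x : ReC (g x) ^+ 2 + ImC (g x) ^+ 2 != 0.
  by rewrite -sqr_cabs expf_neq0 // cabs_eq0.
under eq_fun do rewrite E.
apply: ccontinuousM.
  apply: ccontinuous_real => x; apply: cvgV => //.
  apply: cvgD.
    by under eq_fun do rewrite expr2; apply: cvgM; exact: g1.
  by under eq_fun do rewrite expr2; apply: cvgM; exact: g2.
split => //= x; apply: cvgN; exact: g2.
Qed.

End ComplexMeasurable.

(** * Dominated integrals of complex-valued functions *)

Section ComplexIntegral.
Variable R : realType.
Local Notation C := R[i].
Local Notation mu := (@lebesgue_measure R).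
Implicit Types g h : R -> C.

Definition weighted (K : R) g :=
  cmeasurable g /\ forall x, cabs (g x) <= K * weight x.

Lemma weighted_cintegrable K g : weighted K g -> cintegrable g.
Proof.
move=> [[m1 m2] gK]; split; apply: (weighted_integrable (K := K)) => // x.
  exact: le_trans (Re_le_cabs _) (gK x).
exact: le_trans (Im_le_cabs _) (gK x).
Qed.

(** The factor 2 is the price of estimating the real and the imaginary part separately; it recurs in
    all constants below. *)
Lemma weighted_cint_le K g : weighted K g ->
  cabs (cint g) <= 2 * K * weight_mass R.
Proof.
move=> [[m1 m2] gK]; apply: le_trans (cabs_le _) _ => /=.
rewrite -mulrA mulr_natl mulr2n; apply: lerD; apply: weighted_Rintegral_le => // x.
  exact: le_trans (Re_le_cabs _) (gK x).
exact: le_trans (Im_le_cabs _) (gK x).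
Qed.

(** For majorants other than [weight]: the normal densities of the inversion formula, whose mass
    stays 1 while they concentrate. *)
Lemma dominated_cintegrable g (b : R -> R) : cmeasurable g ->
  mu.-integrable setT (EFin \o b) -> (forall x, cabs (g x) <= b x) -> cintegrable g.
Proof.
move=> [m1 m2] ib gb; split; apply: le_integrable ib => //.
- exact/measurable_EFinP.
- move=> x _ /=; rewrite lee_fin (le_trans (Re_le_cabs _)) // (le_trans (gb x)) //.
  exact: ler_norm.
- exact/measurable_EFinP.
- move=> x _ /=; rewrite lee_fin (le_trans (Im_le_cabs _)) // (le_trans (gb x)) //.
  exact: ler_norm.
Qed.

Lemma dominated_cint_le g (b : R -> R) : cmeasurable g ->
  mu.-integrable setT (EFin \o b) -> (forall x, cabs (g x) <= b x) ->
  cabs (cint g) <= 2 * (\int[mu]_x b x)%R.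
Proof.
move=> mg ib gb; have [i1 i2] := dominated_cintegrable mg ib gb.
apply: le_trans (cabs_le _) _ => /=.
rewrite mulr_natl mulr2n; apply: lerD; apply: le_trans (le_normr_Rintegral _ _) _ => //.
  apply: le_Rintegral => // [|x _]; first exact: (integrable_norm i1).
  exact: le_trans (Re_le_cabs _) (gb x).
apply: le_Rintegral => // [|x _]; first exact: (integrable_norm i2).
exact: le_trans (Im_le_cabs _) (gb x).
Qed.

Lemma weighted_ge0 K g : weighted K g -> 0 <= K.
Proof.
move=> [_ /(_ 0)]/(le_trans (cabs_ge0 _)).
by rewrite pmulr_lge0 // weight_gt0.
Qed.

Lemma weightedD K L g h : weighted K g -> weighted L h ->
  weighted (K + L) (fun x => g x + h x).
Proof.
move=> [mg gK] [mh hL]; split; first exact: cmeasurableD.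
by move=> x; rewrite mulrDl (le_trans (cabsD _ _)) // lerD.
Qed.

Lemma weightedB K L g h : weighted K g -> weighted L h ->
  weighted (K + L) (fun x => g x - h x).
Proof.
move=> [mg gK] [mh hL]; split; first exact: cmeasurableB.
by move=> x; rewrite mulrDl (le_trans (cabsB _ _)) // lerD.
Qed.

Lemma weightedM K L g h : cmeasurable g -> (forall x, cabs (g x) <= L) ->
  weighted K h -> weighted (L * K) (fun x => g x * h x).
Proof.
move=> mg gL [mh hK]; split; first exact: cmeasurableM.
by move=> x; rewrite cabsM -mulrA ler_pM ?cabs_ge0.
Qed.

Lemma weightedZ K c g : weighted K g -> weighted (cabs c * K) (fun x => c * g x).
Proof. by apply: weightedM => //; exact: cmeasurable_cst. Qed.

Lemma eq_cint g h : (forall x, g x = h x) -> cint g = cint h.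
Proof. by move=> E; congr cint; exact/funext. Qed.

Lemma cint0 : cint (fun=> 0 : C) = 0.
Proof.
rewrite /cint /Rintegral /=.
by under eq_integral do rewrite -/(0%E); rewrite integral0.
Qed.

Lemma cintegrableD g h : cintegrable g -> cintegrable h ->
  cintegrable (fun x => g x + h x).
Proof.
move=> [g1 g2] [h1 h2]; split.
  by under eq_fun do rewrite ReCD EFinD; exact: integrableD.
by under eq_fun do rewrite ImCD EFinD; exact: integrableD.
Qed.

Lemma cintD g h : cintegrable g -> cintegrable h ->
  cint (fun x => g x + h x) = cint g + cint h.
Proof.
move=> [g1 g2] [h1 h2]; apply: complex_eq; rewrite !ReImCE /=.
  by under [LHS]eq_Rintegral do rewrite ReCD; exact: RintegralD.
by under [LHS]eq_Rintegral do rewrite ImCD; exact: RintegralD.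
Qed.

Lemma cintegrableZ c g : cintegrable g -> cintegrable (fun x => c * g x).
Proof.
move=> [g1 g2]; split.
  under eq_fun do rewrite ReCM EFinB !EFinM.
  by apply: integrableB => //; exact: integrableZl.
under eq_fun do rewrite ImCM EFinD !EFinM.
by apply: integrableD => //; exact: integrableZl.
Qed.

Lemma cintZ c g : cintegrable g -> cint (fun x => c * g x) = c * cint g.
Proof.
move=> [g1 g2]; apply: complex_eq; rewrite !ReImCE /=.
  under [LHS]eq_Rintegral do rewrite ReCM.
  rewrite RintegralB ?RintegralZl //.
    exact: (integrableZl measurableT _ g1).
  exact: (integrableZl measurableT _ g2).
under [LHS]eq_Rintegral do rewrite ImCM.
rewrite RintegralD ?RintegralZl //.
  exact: (integrableZl measurableT _ g2).
exact: (integrableZl measurableT _ g1).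
Qed.

Lemma cintB g h : cintegrable g -> cintegrable h ->
  cint (fun x => g x - h x) = cint g - cint h.
Proof.
move=> ig ih; rewrite -mulN1r -cintZ // -cintD //; last exact: cintegrableZ.
by apply: eq_cint => x; rewrite mulN1r.
Qed.

Lemma cint_Fubini (G : R * R -> C) K : cmeasurable G ->
  (forall x y, cabs (G (x, y)) <= K * weight x * weight y) ->
  cint (fun x => cint (fun y => G (x, y))) =
  cint (fun y => cint (fun x => G (x, y))).
Proof.
move=> [m1 m2] GK; apply: complex_eq => /=.
  apply: (@weighted_Fubini _ (fun z => ReC (G z)) K) => // x y.
  exact: le_trans (Re_le_cabs _) (GK x y).
apply: (@weighted_Fubini _ (fun z => ImC (G z)) K) => // x y.
exact: le_trans (Im_le_cabs _) (GK x y).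
Qed.

Lemma cmeasurable_cint (G : R * R -> C) K : cmeasurable G ->
  (forall x y, cabs (G (x, y)) <= K * weight x * weight y) ->
  cmeasurable (fun x => cint (fun y => G (x, y))).
Proof.
move=> [m1 m2] GK; split => /=.
  apply: (@weighted_measurable_Rintegral _ (fun z => ReC (G z)) K) => // x y.
  exact: le_trans (Re_le_cabs _) (GK x y).
apply: (@weighted_measurable_Rintegral _ (fun z => ImC (G z)) K) => // x y.
exact: le_trans (Im_le_cabs _) (GK x y).
Qed.

Lemma cint_shift K g (a : R) : ccontinuous g -> weighted K g ->
  cint (fun x => g (x + a)) = cint g.
Proof.
move=> [c1 c2] [_ gK]; apply: complex_eq => /=.
  apply: (@weighted_shift _ (fun z => ReC (g z)) K) => // x.
  exact: le_trans (Re_le_cabs _) (gK x).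
apply: (@weighted_shift _ (fun z => ImC (g z)) K) => // x.
exact: le_trans (Im_le_cabs _) (gK x).
Qed.

End ComplexIntegral.
(** * Complex derivatives and Schwartz functions *)

Section ComplexDerivative.
Variable R : realType.
Local Notation C := R[i].
Implicit Types g h : R -> C.

(** A relation rather than an operator, so that every derivative is carried along as an explicit
    formula to which bounds can be attached. *)
Definition cderivative g g' := forall x : R,
  is_derive x 1 (fun t => ReC (g t)) (ReC (g' x)) /\
  is_derive x 1 (fun t => ImC (g t)) (ImC (g' x)).

Lemma cderivative_continuous g g' : cderivative g g' -> ccontinuous g.
Proof.
move=> D; split=> x; apply/differentiable_continuous/derivable1_diffP.
  by case: (D x) => [[]].
by case: (D x) => [_ []].
Qed.

Lemma cderivative_cst (c : C) : cderivative (fun=> c) (fun=> 0).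
Proof. by move=> x; split; exact: is_derive_cst. Qed.

Lemma cderivative_id : cderivative (fun x => x%:C) (fun=> 1).
Proof. by move=> x; split => /=; [exact: is_derive_id|exact: is_derive_cst]. Qed.

Lemma cderivativeD g h g' h' : cderivative g g' -> cderivative h h' ->
  cderivative (fun x => g x + h x) (fun x => g' x + h' x).
Proof.
move=> Dg Dh x; have [g1 g2] := Dg x; have [h1 h2] := Dh x.
split.
  by under eq_fun do rewrite ReCD; rewrite ReCD; exact: is_deriveD.
by under eq_fun do rewrite ImCD; rewrite ImCD; exact: is_deriveD.
Qed.

Lemma cderivativeM g h g' h' : cderivative g g' -> cderivative h h' ->
  cderivative (fun x => g x * h x) (fun x => g' x * h x + g x * h' x).
Proof.
move=> Dg Dh x; have [g1 g2] := Dg x; have [h1 h2] := Dh x.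
split.
  under eq_fun do rewrite ReCM.
  apply: is_derive_eq (is_deriveB (is_deriveM g1 h1) (is_deriveM g2 h2)) _.
  by rewrite !ReImCE /GRing.scale /=; ring.
under eq_fun do rewrite ImCM.
apply: is_derive_eq (is_deriveD (is_deriveM g1 h2) (is_deriveM g2 h1)) _.
by rewrite !ReImCE /GRing.scale /=; ring.
Qed.

Lemma cderivativeZ c g g' : cderivative g g' ->
  cderivative (fun x => c * g x) (fun x => c * g' x).
Proof.
move=> Dg x; have := cderivativeM (cderivative_cst c) Dg x.
by rewrite mul0r add0r.
Qed.

Lemma cderivative_cexp_i (s : R) :
  cderivative (fun x => cexp ((s * x)*i)) (fun x => s *i * cexp ((s * x)*i)).
Proof.
move=> x; rewrite /cexp /= expR0.
have D : is_derive x 1 (fun t => s * t) s.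
  by apply: is_derive_eq; rewrite /GRing.scale /=; ring.
have Dc := is_derive1_comp (is_derive_cos (s * x)) D.
have Ds := is_derive1_comp (is_derive_sin (s * x)) D.
split.
  rewrite (_ : (fun t => _) = cos \o ( *%R s)); last first.
    by apply/funext => t /=; rewrite mul0r subr0 mul1r.
  by apply: is_derive_eq Dc _; rewrite /=; ring.
rewrite (_ : (fun t => _) = sin \o ( *%R s)); last first.
  by apply/funext => t /=; rewrite mul0r addr0 mul1r.
by apply: is_derive_eq Ds _; rewrite /=; ring.
Qed.

(** Reduces differentiation under an integral to integrating a pointwise quadratic remainder,
    without dominated convergence. *)
Lemma is_derive_quadratic (f : R -> R) (x d K : R) :
  (forall h : R, `|h| <= 1 -> `|f (x + h) - f x - h * d| <= K * h ^+ 2) ->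
  is_derive x 1 f d.
Proof.
move=> H; have K0 : 0 <= K.
  by have := le_trans (normr_ge0 _) (H 1 _); rewrite normr1 expr1n mulr1; apply.
suff L : (h^-1 *: (f (h *: 1 + x) - f x)) @[h --> 0^'] --> d.
  by apply: DeriveDef; [apply/cvg_ex; exists d|apply/cvg_lim].
apply/cvgrPdist_le => e e0; near=> h.
have h0 : h != 0 by near: h; exact: nbhs_dnbhs_neq.
have h1 : `|h| <= 1.
  by near: h; apply: dnbhs0_le.
(* Then [K |h| <= (K + 1) |h| <= e]; the added 1 allows [K = 0]. *)
have h2 : `|h| <= e / (K + 1).
  by near: h; apply: dnbhs0_le; rewrite divr_gt0 // ltr_wpDl.
rewrite /GRing.scale /= mulr1 (addrC h x) distrC.
have -> : h^-1 * (f (x + h) - f x) - d = h^-1 * (f (x + h) - f x - h * d).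
  by rewrite [in RHS]mulrBr mulKf.
rewrite normrM normfV ler_pdivrMl ?normr_gt0 //.
apply: le_trans (H h h1) _; rewrite -real_normK ?num_real // expr2 mulrCA.
rewrite ler_wpM2l //.
move: h2; rewrite ler_pdivlMr ?ltr_wpDl // => h2.
by apply: le_trans h2; rewrite mulrC ler_wpM2l // lerDl.
Unshelve. all: by end_near. Qed.

Lemma cderivative_quadratic g g' :
  (forall x, exists K, forall h : R, `|h| <= 1 ->
     cabs (g (x + h) - g x - h%:C * g' x) <= K * h ^+ 2) ->
  cderivative g g'.
Proof.
move=> H x; have [K HK] := H x; split; apply: (is_derive_quadratic (K := K)) => h h1.
  have := le_trans (Re_le_cabs _) (HK h h1).
  by rewrite !ReImCE /= mul0r subr0.
have := le_trans (Im_le_cabs _) (HK h h1).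
by rewrite !ReImCE /= mul0r addr0.
Qed.

Lemma taylor1 (f f' f'' : R -> R) (x h B : R) :
  (forall y : R, is_derive y 1 f (f' y)) -> (forall y : R, is_derive y 1 f' (f'' y)) ->
  (forall y, `|y - x| <= `|h| -> `|f'' y| <= B) ->
  `|f (x + h) - f x - h * f' x| <= B * h ^+ 2.
Proof.
move=> D1 D2 HB.
have D3 (y : R) : is_derive y 1 (fun t : R => f t - t * f' x) (f' y - f' x).
  have Di : is_derive y 1 (fun t : R => t * f' x) (f' x).
    by apply: is_derive_eq; rewrite /GRing.scale /=; ring.
  exact: is_deriveB.
have [c cx] := mean_value x (x + h) D3.
have [e ex E] := mean_value x c D2.
have -> : f (x + h) - (x + h) * f' x - (f x - x * f' x) = f (x + h) - f x - h * f' x by ring.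
rewrite E => ->; have xh : x + h - x = h by ring.
move: cx; rewrite xh => cx.
rewrite !normrM -real_normK ?num_real // expr2 mulrA.
rewrite ler_wpM2r // ler_pM // HB //.
exact: le_trans cx.
Qed.

(** Replaces the passage to the limit in estimates with a linear rate. *)
Lemma le0_small (a A : R) : (forall h : R, 0 < h -> h <= 1 -> a <= A * h) -> a <= 0.
Proof.
move=> small; apply/ler_addgt0Pr => e e0; rewrite add0r.
have A1 : 0 < `|A| + 1 by rewrite ltr_wpDl.
have hp : 0 < Num.min 1 (e / (`|A| + 1)) by rewrite lt_min ltr01 divr_gt0.
apply: le_trans (small _ hp _) _; first by rewrite ge_min lexx.
apply: (@le_trans _ _ (`|A| * (e / (`|A| + 1)))).
  by apply: (@le_trans _ _ (`|A| * Num.min 1 (e / (`|A| + 1))));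
    rewrite ?(ler_wpM2r (ltW hp)) ?ler_norm // ler_wpM2l // ge_min lexx orbT.
by rewrite mulrCA ger_pMr // ler_pdivrMr // mul1r lerDl.
Qed.

(* By translation invariance [g (x + h) - g x] has integral 0, while its integral
   is also [h] times that of [g'] up to O(h^2). *)
Lemma cint_derivative g g' g'' K K' K'' :
  cderivative g g' -> cderivative g' g'' ->
  weighted K g -> weighted K' g' -> weighted K'' g'' -> cint g' = 0.
Proof.
move=> D1 D2 wg wg' wg''.
have K0 := weighted_ge0 wg''.
have ig := weighted_cintegrable wg; have ig' := weighted_cintegrable wg'.
have cg := cderivative_continuous D1.
have wgh (h : R) : weighted (K * (2 * (1 + h ^+ 2))) (fun x => g (x + h)).
  have [mg gK] := wg; split.
    apply: (cmeasurable_comp mg); apply: continuous_measurable_fun => x.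
    by apply: cvgD; [exact: cvg_id|exact: cvg_cst].
  move=> x; apply: le_trans (gK _) _.
  by rewrite -mulrA ler_wpM2l ?weight_shift // (weighted_ge0 wg).
(* Within distance 1 of [x] the weight grows by a factor of at most 4, so Taylor's formula costs
   [4 * K''] for each of the real and imaginary parts. *)
have bound (h : R) : `|h| <= 1 -> weighted (8 * K'' * h ^+ 2) (fun x => g (x + h) - g x - h%:C * g' x).
  move=> h1; have [m1 _] := weightedB (weightedB (wgh h) wg) (weightedZ h%:C wg').
  split => // x.
  have B y : `|y - x| <= `|h| -> cabs (g'' y) <= 4 * K'' * weight x.
    move=> yx; have [_ b] := wg''; apply: le_trans (b y) _.
    by rewrite (mulrC 4) -mulrA ler_wpM2l // weight_near // (le_trans yx).
  apply: le_trans (cabs_le _) _; rewrite !ReImCE /= mul0r subr0 mul0r addr0.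
  have -> : 8 * K'' * h ^+ 2 * weight x =
    4 * K'' * weight x * h ^+ 2 + 4 * K'' * weight x * h ^+ 2 by ring.
  apply: lerD.
    apply: (@taylor1 (fun y => ReC (g y)) (fun y => ReC (g' y)) (fun y => ReC (g'' y))).
    - by move=> y; case: (D1 y).
    - by move=> y; case: (D2 y).
    - by move=> y yx; apply: le_trans (Re_le_cabs _) (B y yx).
  apply: (@taylor1 (fun y => ImC (g y)) (fun y => ImC (g' y)) (fun y => ImC (g'' y))).
  - by move=> y; case: (D1 y).
  - by move=> y; case: (D2 y).
  - by move=> y yx; apply: le_trans (Im_le_cabs _) (B y yx).
have small (h : R) : 0 < h -> h <= 1 -> cabs (cint g') <= (16 * K'' * weight_mass R) * h.
  move=> h0 h1; have := weighted_cint_le (bound h _).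
  rewrite gtr0_norm // => /(_ h1).
  have igh := weighted_cintegrable (wgh h).
  have i2 : cintegrable (fun x => g (x + h) - g x).
    exact: (weighted_cintegrable (weightedB (wgh h) wg)).
  rewrite (cintB i2 (cintegrableZ _ ig')) (cintB igh ig) (cint_shift h cg wg) subrr sub0r.
  rewrite cabsN (cintZ _ ig') cabsM cabs_real gtr0_norm // => H.
  rewrite -(ler_pM2l h0); apply: le_trans H _.
  by rewrite le_eqVlt; apply/orP; left; apply/eqP; ring.
apply/eqP; rewrite -cabs_eq0 eq_le cabs_ge0 andbT.
exact: le0_small small.
Qed.

(** The whole sequence of derivatives as a witness: closure properties are then proved by exhibiting
    the n-th derivative instead of computing with [derive1n]. *)
Definition schwartz_seq (G : nat -> R -> C) :=
  (forall n, cderivative (G n) (G n.+1)) /\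
  forall j k, exists M : R, forall x, `|x| ^+ j * cabs (G k x) <= M.

Lemma schwartz_seqP g : schwartz g <-> exists2 G, schwartz_seq G & G 0%N = g.
Proof.
split=> [[sg bg]|[G [DG bG] <-]].
  exists (fun n => cderiven n g); last 
    by apply/funext => x; apply: complex_eq.
  split=> // n x; split => /=.
    by apply: DeriveDef; [exact: (sg n x).1|rewrite /= derive1E].
  by apply: DeriveDef; [exact: (sg n x).2|rewrite /= derive1E].
have E n : derive1n n (fun t => ReC (G 0%N t)) = (fun t => ReC (G n t)) /\
           derive1n n (fun t => ImC (G 0%N t)) = (fun t => ImC (G n t)).
  elim: n => [//|n [IH1 IH2]]; rewrite !derive1nS IH1 IH2.
  by split; apply/funext => x; rewrite derive1E; apply: derive_val; case: (DG n x).
split=> [n x|j k].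
  by have [-> ->] := E n; have [[? _] [? _]] := DG n x.
have [M HM] := bG j k; exists M => x; rewrite /cderiven.
by have [-> ->] := E k; case: (G k x) (HM x).
Qed.

Lemma schwartz_derivative g : schwartz g ->
  exists2 g', schwartz g' & cderivative g g'.
Proof.
move=> /schwartz_seqP[G [DG bG] <-]; exists (G 1%N); last exact: DG.
by apply/schwartz_seqP; exists (fun n => G n.+1) => //; split=> // j k; exact: bG.
Qed.

Lemma schwartzZ c g : schwartz g -> schwartz (fun x => c * g x).
Proof.
move=> /schwartz_seqP[G [DG bG] <-]; apply/schwartz_seqP.
exists (fun n x => c * G n x) => //; split=> [n|j k]; first exact: cderivativeZ.
have [M HM] := bG j k; exists (cabs c * M) => x.
by rewrite cabsM mulrCA ler_wpM2l ?cabs_ge0.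
Qed.

Lemma schwartz_mulx g : schwartz g -> schwartz (fun x => x%:C * g x).
Proof.
move=> /schwartz_seqP[G [DG bG] <-]; apply/schwartz_seqP.
(* Leibniz rule for the n-th derivative of [x g]; at [n = 0] the coefficient kills the term with the
   meaningless index [n.-1]. *)
exists (fun n x => x%:C * G n x + n%:R * G n.-1 x); last first.
  by apply/funext => x; rewrite mul0r addr0.
split=> [n x|j k].
  have := cderivativeD (cderivativeM cderivative_id (DG n)) (cderivativeZ n%:R (DG n.-1)) x.
  congr (_ /\ _); congr (is_derive _ _ _ _); congr (_ _).
    by case: n => [|n] /=; rewrite ?mul0r ?addr0 ?mul1r -?(natr1 _ n.+1); ring.
  by case: n => [|n] /=; rewrite ?mul0r ?addr0 ?mul1r -?(natr1 _ n.+1); ring.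
have [M HM] := bG j.+1 k; have [M' HM'] := bG j k.-1.
exists (M + cabs (k%:R : C) * M') => x.
apply: le_trans (ler_wpM2l _ (cabsD _ _)) _; first by rewrite exprn_ge0.
rewrite mulrDr !cabsM; apply: lerD.
  by rewrite mulrA cabs_real -exprSr.
by rewrite mulrCA ler_wpM2l ?cabs_ge0.
Qed.

Lemma schwartz_continuous g : schwartz g -> ccontinuous g.
Proof. by move=> /schwartz_derivative[g' _]; exact: cderivative_continuous. Qed.

Lemma schwartz_bound g n : schwartz g ->
  exists M : R, forall x, `|x| ^+ n * cabs (g x) <= M.
Proof. by move=> /schwartz_seqP[G [_ bG] <-]; exact: bG. Qed.

Lemma schwartz_weighted g : schwartz g -> exists K, weighted K g.
Proof.
move=> sg; have [M0 H0] := schwartz_bound 0 sg; have [M2 H2] := schwartz_bound 2 sg.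
exists (M0 + M2); split; first exact/ccontinuous_measurable/schwartz_continuous.
move=> x; apply: le_weight.
have := H0 x; have := H2 x; rewrite expr0 mul1r real_normK ?num_real //; lra.
Qed.

End ComplexDerivative.
(** * Fourier transforms of Schwartz functions *)

Section FourierTransform.
Variable R : realType.
Local Notation C := R[i].
Implicit Types (g h : R -> C) (s t x y K : R).

(** The sign [s] treats the Fourier transform ([s = 1]) and, up to the factor [2 pi], its inverse
    ([s = -1]) together. *)
Definition ft s g t : C := cint (fun x => cexp ((s * (x * t))*i) * g x).

Lemma fourierE g : fourier g = ft 1 g.
Proof. by apply/funext => t; apply: eq_cint => x; rewrite mul1r. Qed.

Lemma cabs_cexp_i y : cabs (cexp (y *i)) = 1.
Proof. by rewrite cabs_cexp /= expR0. Qed.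

Lemma continuous_scale (a : R) : continuous (fun x => a * x).
Proof. by move=> x; apply: cvgM; [exact: cvg_cst|exact: cvg_id]. Qed.

Lemma continuous_kernel (s t : R) : continuous (fun x => s * (x * t)).
Proof.
have -> : (fun x => s * (x * t)) = *%R (s * t) by apply/funext => x; ring.
exact: continuous_scale.
Qed.

Lemma ft_kernel_weighted s t K g : weighted K g ->
  weighted K (fun x => cexp ((s * (x * t))*i) * g x).
Proof.
move=> wg; rewrite -[K]mul1r.
apply: (@weightedM _ K 1 (fun x => cexp ((s * (x * t))*i)) g _ _ wg) => [|x].
  apply: ccontinuous_measurable; apply: ccontinuous_cexp; apply: ccontinuous_i.
  exact: continuous_kernel.
by rewrite cabs_cexp_i.
Qed.

Lemma ft_le s t K g : weighted K g -> cabs (ft s g t) <= 2 * K * weight_mass R.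
Proof. by move=> wg; apply: weighted_cint_le; exact: ft_kernel_weighted. Qed.

Lemma ftZ s c g t : cintegrable (fun x => cexp ((s * (x * t))*i) * g x) ->
  ft s (fun x => c * g x) t = c * ft s g t.
Proof. by move=> ig; rewrite /ft -cintZ //; apply: eq_cint => x; ring. Qed.

Lemma ft_is_derivative s K0 K1 K2 g : weighted K0 g ->
  weighted K1 (fun x => x%:C * g x) ->
  weighted K2 (fun x => (x ^+ 2)%:C * g x) ->
  cderivative (ft s g) (ft s (fun x => s *i * (x%:C * g x))).
Proof.
move=> w0 w1 w2; apply: cderivative_quadratic => t.
(* The Taylor remainder of the kernel is at most [4 s^2 h^2 x^2], and [K2] bounds [x^2 g]; the outer
   2 comes from [weighted_cint_le]. *)
exists (2 * (4 * s ^+ 2 * K2) * weight_mass R) => h h1.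
have i0 u := weighted_cintegrable (ft_kernel_weighted s u w0).
have i1 := weighted_cintegrable (ft_kernel_weighted s t (weightedZ (s *i) w1)).
have i01 : cintegrable (fun x => cexp ((s * (x * (t + h)))*i) * g x
    - cexp ((s * (x * t))*i) * g x).
  rewrite (_ : (fun x => _) = (fun x => cexp ((s * (x * (t + h)))*i) * g x
    + (-1) * (cexp ((s * (x * t))*i) * g x))).
    by apply: cintegrableD => //; exact: cintegrableZ.
  by apply/funext => x; rewrite mulN1r.
rewrite /ft -cintZ // -cintB // -cintB //; last exact: cintegrableZ.
rewrite (_ : _ * h ^+ 2 = 2 * (4 * s ^+ 2 * K2 * h ^+ 2) * weight_mass R); last by ring.
apply: weighted_cint_le.
have [m0 _] := ft_kernel_weighted s (t + h) w0.
have [m0' _] := ft_kernel_weighted s t w0.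
have [m1 _] := ft_kernel_weighted s t (weightedZ (s *i) w1).
split.
  by apply: cmeasurableB; [exact: cmeasurableB|apply: cmeasurableM => //; exact: cmeasurable_cst].
move=> x.
rewrite (_ : _ - _ = cexp ((s * (x * t))*i) * g x *
    (cexp ((s * (x * h))*i) - 1 - (s * (x * h))*i)); last first.
  rewrite (_ : (s * (x * (t + h)))*i = (s * (x * t))*i + (s * (x * h))*i); last first.
    by apply: complex_eq; rewrite /=; ring.
  rewrite cexpD (_ : (s * (x * h))*i = h%:C * (s *i * x%:C)); last first.
    by apply: complex_eq; rewrite /=; ring.
  by ring.
have [_ b2] := w2.
have Q := cexpB1Bid_le ((s * (x * h))*i); rewrite /= normr0 expR0 mulr1 cabs_i in Q.
rewrite cabsM [cabs (_ * g x)]cabsM cabs_cexp_i mul1r.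
apply: le_trans (ler_wpM2l (cabs_ge0 _) Q) _.
rewrite real_normK ?num_real //.
have := b2 x; rewrite cabsM cabs_real ger0_norm ?sqr_ge0 // => B.
rewrite [leLHS](_ : _ = 4 * s ^+ 2 * h ^+ 2 * (x ^+ 2 * cabs (g x))); last by ring.
rewrite (_ : 4 * s ^+ 2 * K2 * h ^+ 2 * weight x = 4 * s ^+ 2 * h ^+ 2 * (K2 * weight x)); last by ring.
by rewrite ler_wpM2l // -mulrA mulr_ge0 // mulr_ge0 ?sqr_ge0.
Qed.

(** Integration by parts: the derivative of the kernel times [g] has integral 0 by
    [cint_derivative]. That lemma controls a second-order remainder, whence [g'']. *)
Lemma ft_derivative s t K0 K1 K2 g g' g'' :
  cderivative g g' -> cderivative g' g'' ->
  weighted K0 g -> weighted K1 g' -> weighted K2 g'' ->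
  ft s g' t = - ((s * t)*i * ft s g t).
Proof.
move=> D1 D2 w0 w1 w2.
pose E x := cexp ((s * (x * t))*i); pose c := (s * t)*i.
have DE : cderivative E (fun x => c * E x).
  rewrite /E /c; have := cderivative_cexp_i (s * t).
  by congr (cderivative _ _); apply/funext => x; rewrite -mulrA (mulrC t).
have wE K u : weighted K u -> weighted K (fun x => E x * u x) by exact: ft_kernel_weighted.
have DEg := cderivativeM DE D1.
have DEg' := cderivativeM DE D2.
have E1 : (fun x => c * E x * g x + E x * g' x) = (fun x => c * (E x * g x) + E x * g' x).
  by apply/funext => x; rewrite mulrA.
rewrite E1 in DEg.
have D3 := cderivativeD (cderivativeZ c DEg) DEg'.
have E2 : (fun x => c * (c * (E x * g x) + E x * g' x) + (c * E x * g' x + E x * g'' x)) =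
  (fun x => c * (c * (E x * g x) + E x * g' x) + (c * (E x * g' x) + E x * g'' x)).
  by apply/funext => x; rewrite (mulrA c (E x) (g' x)).
rewrite E2 in D3.
have wA := weightedD (weightedZ c (wE _ _ w0)) (wE _ _ w1).
have wB := weightedD (weightedZ c wA) (weightedD (weightedZ c (wE _ _ w1)) (wE _ _ w2)).
have i0 := weighted_cintegrable (wE _ _ w0).
have := cint_derivative DEg D3 (wE _ _ w0) wA wB.
rewrite cintD ?cintZ //; last 2 first.
- exact: cintegrableZ.
- exact: (weighted_cintegrable (wE _ _ w1)).
by move/eqP; rewrite addrC addr_eq0 => /eqP.
Qed.

Lemma schwartz_ft_derivative s t g g' : schwartz g -> cderivative g g' ->
  schwartz g' -> ft s g' t = - ((s * t)*i * ft s g t).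
Proof.
move=> sg D1 sg'; have [g'' sg'' D2] := schwartz_derivative sg'.
have [? w0] := schwartz_weighted sg; have [? w1] := schwartz_weighted sg'.
have [? w2] := schwartz_weighted sg''.
exact: ft_derivative D1 D2 w0 w1 w2.
Qed.

(** Each power of [t] is traded for one derivative of [g], since
    [|s t| |ft s g t| = |ft s g' t|]. *)
Lemma schwartz_ft_decay s g j : s != 0 -> schwartz g ->
  exists M : R, forall t, `|t| ^+ j * cabs (ft s g t) <= M.
Proof.
move=> s0; elim: j g => [|j IH] g sg.
  have [K wg] := schwartz_weighted sg; exists (2 * K * weight_mass R) => t.
  by rewrite expr0 mul1r ft_le.
have [g' sg' D] := schwartz_derivative sg.
have [M HM] := IH _ sg'; exists (M / `|s|) => t.
rewrite ler_pdivlMr ?normr_gt0 //; apply: le_trans (HM t).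
rewrite (schwartz_ft_derivative s t sg D sg') cabsN cabsM cabs_i normrM exprSr.
by rewrite le_eqVlt; apply/orP; left; apply/eqP; ring.
Qed.

Lemma schwartz_ft s g : s != 0 -> schwartz g -> schwartz (ft s g).
Proof.
move=> s0 sg; apply/schwartz_seqP.
(* Differentiating the transform multiplies the function by [i s x], so the n-th derivative of
   [ft s g] is the transform of the n-th iterate of [X] at [g]. *)
pose X (u : R -> C) x := s *i * (x%:C * u x).
have sX n : schwartz (iter n X g).
  by elim: n => [//|n IH] /=; apply/schwartzZ/schwartz_mulx.
exists (fun n => ft s (iter n X g)) => //; split=> [n|j k]; last exact: schwartz_ft_decay.
have s1 := schwartz_mulx (sX n); have s2 := schwartz_mulx s1.
have [? w0] := schwartz_weighted (sX n); have [? w1] := schwartz_weighted s1.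
have [K2 w2] := schwartz_weighted s2.
apply: (ft_is_derivative _ w0 w1 (K2 := K2)).
by under eq_fun do rewrite expr2 rmorphM -mulrA.
Qed.

End FourierTransform.
(** * Fourier inversion *)

Section FourierInversion.
Variable R : realType.
Local Notation C := R[i].
Local Notation mu := (@lebesgue_measure R).
Implicit Types (g h : R -> C) (e s t x y K : R).

(** Scaled so that it tends to 1 as [e] tends to 0, while its Fourier transform is [2 pi] times the
    normal density of standard deviation [e]. *)
Definition gauss e x : R := expR (- ((e * x) ^+ 2 / 2)).

Lemma gauss_ge0 e x : 0 <= gauss e x. Proof. exact: expR_ge0. Qed.

Lemma gauss_le1 e x : gauss e x <= 1.
Proof. by rewrite -expR0 ler_expR oppr_le0 divr_ge0 ?sqr_ge0. Qed.

Lemma is_derive_gauss e x : is_derive x 1 (gauss e) (- e ^+ 2 * (x * gauss e x)).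
Proof.
have D : is_derive x 1 (fun y : R => - ((e * y) ^+ 2 / 2)) (- e ^+ 2 * x).
  apply: is_derive_eq; rewrite /GRing.scale /=; lra.
by apply: is_derive_eq (is_derive1_comp (is_derive_expR _) D) _; rewrite /gauss; ring.
Qed.

Lemma continuous_gauss e : continuous (gauss e).
Proof.
move=> x; apply/differentiable_continuous/derivable1_diffP.
by case: (is_derive_gauss e x).
Qed.

Lemma gauss_weighted e (a : R -> R) : 0 < e -> continuous a ->
  (forall x, `|a x| <= 1 + x ^+ 2) ->
  weighted ((1 + 4 / e ^+ 2) ^+ 2) (fun x => (a x * gauss e x)%:C).
Proof.
move=> e0 ca ha; split.
  apply: ccontinuous_measurable; apply: ccontinuous_real => x.
  by apply: cvgM; [exact: ca|exact: continuous_gauss].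
move=> x; rewrite cabs_real normrM (ger0_norm (gauss_ge0 _ _)).
apply: le_weight; set A := 1 + 4 / e ^+ 2.
have e20 : 0 < e ^+ 2 by rewrite exprn_gt0.
have A1 : 0 <= 4 / e ^+ 2 by rewrite divr_ge0 // ltW.
(* Chosen so that [1 + x^2 <= A w] and [w <= expR (e^2 x^2 / 4)]. The square of this exponential is
   the inverse of [gauss e x], so the Gaussian outweighs [(1 + x^2)^2 / A^2]. *)
pose w := 1 + e ^+ 2 * x ^+ 2 / 4.
have x20 := sqr_ge0 x.
have ex0 : 0 <= e ^+ 2 * x ^+ 2 by rewrite mulr_ge0 ?sqr_ge0.
have wA : 1 + x ^+ 2 <= A * w.
  rewrite /A /w.
  have -> : (1 + 4 / e ^+ 2) * (1 + e ^+ 2 * x ^+ 2 / 4) =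
    1 + x ^+ 2 + 4 / e ^+ 2 + e ^+ 2 * x ^+ 2 / 4 by field; rewrite gt_eqF.
  lra.
have gw : gauss e x * w ^+ 2 <= 1.
  have w1 : 0 <= w by rewrite /w; lra.
  rewrite /gauss expRN mulrC ler_pdivrMr ?expR_gt0 // mul1r.
  have -> : expR ((e * x) ^+ 2 / 2) = expR (e ^+ 2 * x ^+ 2 / 4) ^+ 2.
    by rewrite -expRM_natl; congr expR; field.
  by rewrite ler_sqr ?nnegrE ?expR_ge0 // /w expR_ge1Dx.
apply: (@le_trans _ _ ((A * w) * gauss e x * (A * w))).
  by rewrite ler_pM ?mulr_ge0 ?gauss_ge0 ?ler_wpM2r ?gauss_ge0 ?ler_pM // ?(le_trans (ha x)) //; lra.
rewrite (_ : _ * _ = A ^+ 2 * (gauss e x * w ^+ 2)); last by ring.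
by rewrite ler_piMr ?sqr_ge0.
Qed.

Lemma cderivative_real (u u' : R -> R) : (forall x : R, is_derive x 1 u (u' x)) ->
  cderivative (fun x => (u x)%:C) (fun x => (u' x)%:C).
Proof. by move=> D x; split => /=; [exact: D|exact: is_derive_cst]. Qed.

Lemma cderivative0 g : cderivative g (fun=> 0) -> forall x, g x = g 0.
Proof.
move=> D x; apply: complex_eq.
  have [|c _] := @mean_value R (fun t => ReC (g t)) (fun=> 0) 0 x.
    by move=> y; case: (D y).
  by rewrite mul0r => /eqP; rewrite subr_eq0 => /eqP.
have [|c _] := @mean_value R (fun t => ImC (g t)) (fun=> 0) 0 x.
  by move=> y; case: (D y).
by rewrite mul0r => /eqP; rewrite subr_eq0 => /eqP.
Qed.

(** The derivative of the transform is [i] times the transform of [x g]; as [g' = - e^2 x g],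
    integration by parts turns the latter into [i t / e^2] times the transform of [g]. *)
Lemma ft_gauss_ode e : 0 < e ->
  cderivative (ft 1 (fun x => (gauss e x)%:C))
    (fun t => (- (t / e ^+ 2))%:C * ft 1 (fun x => (gauss e x)%:C) t).
Proof.
move=> e0; set g := fun x : R => (gauss e x)%:C.
have e2 : e ^+ 2 != 0 by rewrite gt_eqF // exprn_gt0.
have bx x : `|x| <= 1 + x ^+ 2.
  by have := sqr_ge0 (`|x| - 1); rewrite -(real_normK (num_real x)) !expr2; nra.
have w0 : weighted ((1 + 4 / e ^+ 2) ^+ 2) g.
  have -> : g = (fun x => (1 * gauss e x)%:C) by apply/funext => x; rewrite mul1r.
  apply: (@gauss_weighted e (fun=> 1)) => // x; first exact: cvg_cst.
  by rewrite normr1 lerDl sqr_ge0.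
have w1 := gauss_weighted e0 (a := fun x => x) (fun x => @cvg_id _ _) bx.
have w2 : weighted ((1 + 4 / e ^+ 2) ^+ 2) (fun x => (x ^+ 2 * gauss e x)%:C).
  apply: gauss_weighted => // x; first exact: sqr_continuous.
  by rewrite ger0_norm ?sqr_ge0 // lerDr.
have D1 : cderivative g (fun x => (- e ^+ 2)%:C * (x * gauss e x)%:C).
  have := cderivative_real (is_derive_gauss e).
  by congr (cderivative _ _); apply/funext => x; rewrite -rmorphM.
have D2 : cderivative (fun x => (- e ^+ 2)%:C * (x * gauss e x)%:C)
  (fun x => (- e ^+ 2)%:C * (g x + (- e ^+ 2)%:C * (x ^+ 2 * gauss e x)%:C)).
  apply: cderivativeZ.
  rewrite (_ : (fun x => (x * gauss e x)%:C) = (fun x => x%:C * g x)); last first.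
    by apply/funext => x; apply: complex_eq; rewrite !ReImCE /=; ring.
  have := cderivativeM (@cderivative_id R) D1.
  congr (cderivative _ _); apply/funext => x.
  by rewrite mul1r -!rmorphM; congr (_ + _%:C); ring.
have wx := weightedZ (- e ^+ 2)%:C w1.
have wxx := weightedZ (- e ^+ 2)%:C (weightedD w0 (weightedZ (- e ^+ 2)%:C w2)).
have E t : ft 1 (fun x => (x * gauss e x)%:C) t = (t / e ^+ 2)*i * ft 1 g t.
  have := ft_derivative 1 t D1 D2 w0 wx wxx.
  rewrite ftZ; last exact: (weighted_cintegrable (ft_kernel_weighted _ _ w1)).
  move=> H; apply: (@mulfI _ (- e ^+ 2)%:C).
    by rewrite -cabs_eq0 cabs_real normr_eq0 oppr_eq0.
  rewrite H mul1r mulrA -mulNr; congr (_ * _).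
  by apply: complex_eq; rewrite ?ReImCE /=; field; rewrite gt_eqF.
have := @ft_is_derivative R 1 _ _ _ g w0 _ _.
move=> /(_ ((1 + 4 / e ^+ 2) ^+ 2) ((1 + 4 / e ^+ 2) ^+ 2)).
have -> : (fun x => x%:C * g x) = (fun x => (x * gauss e x)%:C).
  by apply/funext => x; apply: complex_eq; rewrite !ReImCE /=; ring.
have -> : (fun x => (x ^+ 2)%:C * g x) = (fun x => (x ^+ 2 * gauss e x)%:C).
  by apply/funext => x; apply: complex_eq; rewrite !ReImCE /=; ring.
move=> /(_ w1 w2); congr (cderivative _ _); apply/funext => t.
rewrite ftZ; last first.
  have := weighted_cintegrable (ft_kernel_weighted 1 t w1).
  by rewrite /g; under eq_fun do rewrite rmorphM.
have <- : (fun x => (x * gauss e x)%:C) = (fun x => x%:C * g x).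
  by apply/funext => x; apply: complex_eq; rewrite !ReImCE /=; ring.
rewrite E mulrA; congr (_ * _); by apply: complex_eq; rewrite !ReImCE /=; field; rewrite gt_eqF.
Qed.

Lemma normal_pdf0E e x : e != 0 ->
  normal_pdf 0 e x = normal_peak e * expR (- (x ^+ 2 / (2 * e ^+ 2))).
Proof.
move=> e0; rewrite normal_pdfE // /normal_fun subr0.
by congr (_ * expR _); rewrite mulNr -mulr_natl.
Qed.

Lemma ft_gauss0 e : 0 < e -> ft 1 (fun x => (gauss e x)%:C) 0 = ((normal_peak e^-1)^-1)%:C.
Proof.
move=> e0; have ei : e^-1 != 0 by rewrite invr_eq0 gt_eqF.
have -> : ft 1 (fun x => (gauss e x)%:C) 0 = cint (fun x => (gauss e x)%:C).
  apply: eq_cint => x.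
  by rewrite (_ : (1 * (x * 0))*i = 0) ?cexp0 ?mul1r // !mulr0.
apply: complex_eq => /=; last by rewrite /Rintegral integral0.
have pk := normal_peak_gt0 ei.
have E x : gauss e x = (normal_peak e^-1)^-1 * normal_pdf 0 e^-1 x.
  rewrite normal_pdf0E // mulKf ?gt_eqF // /gauss; congr (expR (- _)).
  by field; rewrite gt_eqF.
under eq_Rintegral do rewrite E.
rewrite RintegralZl //; last exact: integrable_normal_pdf.
by rewrite /Rintegral integral_normal_pdf mulr1.
Qed.

Lemma ft_gauss e t : 0 < e ->
  ft 1 (fun x => (gauss e x)%:C) t = (2 * pi * normal_pdf 0 e t)%:C.
Proof.
move=> e0; have en : e != 0 by rewrite gt_eqF.
(* [expR (u t)] is an integrating factor: its product with the transform has derivative 0, hence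
   equals its value at 0. *)
pose u t := t ^+ 2 / (2 * e ^+ 2).
have Du t' : is_derive t' 1 (fun y : R => expR (u y)) (t' / e ^+ 2 * expR (u t')).
  have D : is_derive t' 1 u (t' / e ^+ 2).
    by apply: is_derive_eq; rewrite /GRing.scale /=; field.
  by apply: is_derive_eq (is_derive1_comp (is_derive_expR _) D) _; ring.
have D := cderivativeM (ft_gauss_ode e0) (cderivative_real Du).
have Z : (fun x => (- (x / e ^+ 2))%:C * ft 1 (fun x => (gauss e x)%:C) x * (expR (u x))%:C +
   ft 1 (fun x => (gauss e x)%:C) x * (x / e ^+ 2 * expR (u x))%:C) = (fun=> 0).
  by apply/funext => x; apply: complex_eq; rewrite !ReImCE /=; ring.
rewrite Z in D.
have := cderivative0 D t; rewrite /= ft_gauss0 // {2}/u expr0n /= mul0r expR0 mulr1.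
have eu : (expR (u t))%:C != 0 :> C by rewrite -cabs_eq0 cabs_real normr_eq0 gt_eqF // expR_gt0.
move=> /(canRL (mulfK eu)) ->.
rewrite normal_pdf0E // expRN -/(u t) -fmorphV -rmorphM; congr (_%:C).
rewrite mulrA; congr (_ / _); rewrite /normal_peak invrK.
have p0 : 0 <= pi :> R by exact: pi_ge0.
have -> : e^-1 ^+ 2 * pi *+ 2 = e^-1 ^+ 2 * (2 * pi) by ring.
have -> : e ^+ 2 * pi *+ 2 = e ^+ 2 * (2 * pi) by ring.
rewrite (sqrtrM (2 * pi) (sqr_ge0 e)) (sqrtrM (2 * pi) (sqr_ge0 e^-1)).
rewrite !sqrtr_sqr !gtr0_norm ?invr_gt0 //.
set r := Num.sqrt _.
have r0 : r != 0 by rewrite gt_eqF // sqrtr_gt0 mulr_gt0 // pi_gt0.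
have -> : 2 * pi = r ^+ 2 by rewrite sqr_sqrtr // mulr_ge0.
by field; rewrite en r0.
Qed.

(** Bounds the first moment through the mass 1 of a wider density. With [v = x^2 / (4 e^2)],
    [|x| / e <= 1 + v <= expR v], and the exponents satisfy [v - 2 v <= - v / 2]. *)
Lemma normal_pdf_first_moment e x : 0 < e ->
  `|x| * normal_pdf 0 e x <= 2 * e * normal_pdf 0 (2 * e) x.
Proof.
move=> e0; have en : e != 0 by rewrite gt_eqF.
have en2 : 2 * e != 0 by rewrite gt_eqF // mulr_gt0.
rewrite !normal_pdf0E //.
have -> : normal_peak (2 * e) = normal_peak e / 2.
  rewrite /normal_peak; set P := e ^+ 2 * pi *+ 2.
  have -> : (2 * e) ^+ 2 * pi *+ 2 = P * 2 ^+ 2 by rewrite /P; ring.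
  have P0 : 0 <= P by rewrite /P mulrn_wge0 // mulr_ge0 ?sqr_ge0 ?pi_ge0.
  by rewrite (sqrtrM _ P0) sqrtr_sqr gtr0_norm // invfM.
have pk := normal_peak_gt0 en.
rewrite mulrCA [leRHS](_ : _ = normal_peak e * (e * expR (- (x ^+ 2 / (2 * (2 * e) ^+ 2))))); last by field.
rewrite ler_pM2l // -ler_pdivrMl // mulrA.
pose v := x ^+ 2 / (4 * e ^+ 2).
have v0 : 0 <= v by rewrite divr_ge0 ?sqr_ge0 ?(mulr_ge0 (ler0n _ 4)) ?sqr_ge0.
apply: (@le_trans _ _ (expR v * expR (- (x ^+ 2 / (2 * e ^+ 2))))).
  rewrite ler_wpM2r ?expR_ge0 //; apply: le_trans (expR_ge1Dx _).
  rewrite -subr_ge0; have -> : 1 + v - e^-1 * `|x| = (1 - `|x| / (2 * e)) ^+ 2.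
    rewrite /v -(real_normK (num_real x)); field; exact: en.
  exact: sqr_ge0.
rewrite -expRD ler_expR -subr_ge0.
have -> : - (x ^+ 2 / (2 * (2 * e) ^+ 2)) - (v + - (x ^+ 2 / (2 * e ^+ 2))) = v / 2.
  by rewrite /v; field.
by rewrite divr_ge0.
Qed.

Lemma schwartz_lipschitz h : schwartz h ->
  exists L, forall x y, cabs (h x - h y) <= L * `|x - y|.
Proof.
move=> sh; have [h' sh' D] := schwartz_derivative sh.
have [M HM] := schwartz_bound 0 sh'.
exists (2 * M) => x y; apply: le_trans (cabs_le _) _; rewrite !ReImCE.
rewrite -mulrA mulr_natl mulr2n.
have B z : cabs (h' z) <= M by have := HM z; rewrite expr0 mul1r.
apply: lerD.
  have [|c _ ->] := @mean_value R (fun t => ReC (h t)) (fun t => ReC (h' t)) y x.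
    by move=> z; case: (D z).
  by rewrite normrM ler_wpM2r // (le_trans (Re_le_cabs _)).
have [|c _ ->] := @mean_value R (fun t => ImC (h t)) (fun t => ImC (h' t)) y x.
  by move=> z; case: (D z).
by rewrite normrM ler_wpM2r // (le_trans (Im_le_cabs _)).
Qed.

Lemma normal_pdf_center e t y : e != 0 -> normal_pdf t e y = normal_pdf 0 e (y - t).
Proof. by move=> e0; rewrite !normal_pdfE // /normal_fun subr0. Qed.

Lemma normal_pdfN e y : e != 0 -> normal_pdf 0 e (- y) = normal_pdf 0 e y.
Proof. by move=> e0; rewrite !normal_pdf0E // sqrrN. Qed.

Lemma Rintegral_normal_pdf m e : (\int[mu]_x normal_pdf m e x)%R = 1.
Proof. by rewrite /Rintegral integral_normal_pdf. Qed.

Lemma gauss_near1 e x : 1 - gauss e x <= e ^+ 2 * x ^+ 2.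
Proof.
have := expR_ge1Dx (- ((e * x) ^+ 2 / 2)); rewrite -/(gauss e x) exprMn.
by have := mulr_ge0 (sqr_ge0 e) (sqr_ge0 x); lra.
Qed.

(* The convolution of h with the heat kernel [normal_pdf t e] is read off from
   the Fourier side, where it is multiplication by a Gaussian. *)
Lemma ft_gauss_regularized e h t : 0 < e -> schwartz h ->
  cint (fun x => cexp ((1 * (x * t))*i) * (ft (-1) h x * (gauss e x)%:C)) =
  cint (fun y => h y * (2 * pi * normal_pdf t e y)%:C).
Proof.
move=> e0 sh; have [K wh] := schwartz_weighted sh.
have wg : weighted ((1 + 4 / e ^+ 2) ^+ 2) (fun x => (gauss e x)%:C).
  have -> : (fun x => (gauss e x)%:C) = (fun x => (1 * gauss e x)%:C) :> (R -> C).
    by apply/funext => x; rewrite mul1r.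
  apply: (@gauss_weighted e (fun=> 1)) => // x; first exact: cvg_cst.
  by rewrite normr1 lerDl sqr_ge0.
set A := (1 + _) ^+ 2 in wg; have A0 := weighted_ge0 wg.
pose G (z : R * R) : C := cexp ((1 * (z.1 * t))*i) * (gauss e z.1)%:C *
  (cexp ((- 1 * (z.2 * z.1))*i) * h z.2).
have mG : cmeasurable G.
  have m1 : measurable_fun setT (fun z : R * R => z.1) by exact: measurable_fst.
  have m2 : measurable_fun setT (fun z : R * R => z.2) by exact: measurable_snd.
  apply: cmeasurableM; apply: cmeasurableM.
  - apply: cmeasurable_cexp; apply: cmeasurable_i.
    by apply: measurable_funM => //; exact: measurable_funM.
  - exact: (@cmeasurable_comp _ _ _ _ _ (fun x => (gauss e x)%:C) fst wg.1 m1).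
  - apply: cmeasurable_cexp; apply: cmeasurable_i.
    by apply: measurable_funM => //; exact: measurable_funM.
  - exact: (@cmeasurable_comp _ _ _ _ _ h snd wh.1 m2).
have GK x y : cabs (G (x, y)) <= A * K * weight x * weight y.
  rewrite /G /= cabsM [cabs (_ * (gauss _ _)%:C)]cabsM cabs_cexp_i mul1r.
  rewrite [cabs (_ * h y)]cabsM cabs_cexp_i mul1r.
  rewrite (_ : A * K * _ * _ = A * weight x * (K * weight y)); last by ring.
  by rewrite ler_pM ?cabs_ge0 // ?wg.2 ?wh.2.
transitivity (cint (fun x => cint (fun y => G (x, y)))).
  apply: eq_cint => x; rewrite /G /= cintZ; last first.
    exact: (weighted_cintegrable (ft_kernel_weighted _ _ wh)).
  by rewrite -/(ft (-1) h x); ring.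
rewrite (cint_Fubini mG GK); apply: eq_cint => y; rewrite /G /=.
have en : e != 0 by rewrite gt_eqF.
(* The density is even, so its value at [y - t] is that at [t - y], which is the transform of the
   Gaussian at [t - y]. *)
rewrite normal_pdf_center // -normal_pdfN // opprB -ft_gauss // -cintZ; last first.
  exact: (weighted_cintegrable (ft_kernel_weighted _ _ wg)).
apply: eq_cint => x.
rewrite (_ : (1 * (x * (t - y)))*i = (1 * (x * t))*i + (-1 * (y * x))*i); last first.
  by apply: complex_eq; rewrite /=; ring.
by rewrite cexpD; ring.
Qed.

(** The Gaussian-regularized integral lies within O(e) of both sides, so their distance is O(e) for
    every small [e]. *)
Lemma ft_inversion h t : schwartz h -> ft 1 (ft (-1) h) t = (2 * pi)%:C * h t.
Proof.
move=> sh; have [K wh] := schwartz_weighted sh.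
have N10 : (-1 : R) != 0 by rewrite oppr_eq0 oner_eq0.
have sf := schwartz_ft N10 sh; set f := ft (-1) h in sf *.
have [Kf wf] := schwartz_weighted sf.
have [K2 w2] := schwartz_weighted (schwartz_mulx (schwartz_mulx sf)).
have [L HL] := schwartz_lipschitz sh.
have p0 : 0 <= pi :> R by exact: pi_ge0.
(* Removing the Gaussian costs [1 - gauss e x <= e^2 x^2 <= e x^2], and [K2] bounds [x^2 f]. *)
have first e : 0 < e -> e <= 1 ->
  cabs (ft 1 f t - cint (fun x => cexp ((1 * (x * t))*i) * (f x * (gauss e x)%:C)))
    <= 2 * (K2 * e) * weight_mass R.
  move=> e0 e1.
  have mg : cmeasurable (fun x => (gauss e x)%:C).
    by apply: ccontinuous_measurable; apply: ccontinuous_real; exact: continuous_gauss.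
  have wfg : weighted (1 * Kf) (fun x => f x * (gauss e x)%:C).
    have g1 x : cabs (gauss e x)%:C <= 1.
      by rewrite cabs_real ger0_norm ?gauss_ge0 ?gauss_le1.
    have [_ b] := weightedM mg g1 wf.
    split=> [|x]; last by rewrite mulrC; exact: b.
    by apply: cmeasurableM => //; case: wf.
  have k1 := ft_kernel_weighted 1 t wf; have k2 := ft_kernel_weighted 1 t wfg.
  rewrite /ft -cintB; [|exact: (weighted_cintegrable k1)|exact: (weighted_cintegrable k2)].
  apply: weighted_cint_le; split.
    by apply: cmeasurableB; [case: k1|case: k2].
  move=> x; rewrite -mulrBr cabsM cabs_cexp_i mul1r.
  rewrite (_ : f x - _ = (1 - gauss e x)%:C * f x); last by rewrite rmorphB rmorph1; ring.
  rewrite cabsM cabs_real ger0_norm ?subr_ge0 ?gauss_le1 //.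
  have := w2.2 x; rewrite mulrA cabsM -rmorphM cabs_real -expr2 ger0_norm ?sqr_ge0 // => B.
  apply: le_trans (ler_wpM2r (cabs_ge0 _) (gauss_near1 e x)) _.
  rewrite (_ : K2 * e * weight x = e * (K2 * weight x)); last by ring.
  rewrite -mulrA; apply: ler_pM => //.
  - by rewrite sqr_ge0.
  - by rewrite mulr_ge0 ?sqr_ge0 ?cabs_ge0.
  by rewrite expr2 ler_piMr // ltW.
(* Averaging [h] against the density moves it by at most its Lipschitz constant times the first
   moment, which is at most [2 e]. *)
have second e : 0 < e -> cabs (cint (fun y => h y * (2 * pi * normal_pdf t e y)%:C) - (2 * pi)%:C * h t)
    <= 2 * (4 * pi * L * e).
  move=> e0; have en : e != 0 by rewrite gt_eqF.
  have en2 : 2 * e != 0 by rewrite gt_eqF // mulr_gt0.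
  have L0 : 0 <= L.
    by have := le_trans (cabs_ge0 _) (HL 1 0); rewrite subr0 normr1 mulr1.
  have iN c : cintegrable (fun y => (c * normal_pdf t e y)%:C).
    split=> /=; last exact: integrable0.
    exact: (integrableZl measurableT c (integrable_normal_pdf t e)).
  have E : (2 * pi)%:C * h t = cint (fun y => h t * (2 * pi * normal_pdf t e y)%:C).
    rewrite cintZ // mulrC; congr (_ * _).
    apply: complex_eq => /=; last by rewrite /Rintegral integral0.
    by rewrite RintegralZl // ?Rintegral_normal_pdf ?mulr1 //; exact: integrable_normal_pdf.
  have mN : cmeasurable (fun y => (2 * pi * normal_pdf t e y)%:C).
    apply: ccontinuous_measurable; apply: ccontinuous_real => y.
    by apply: cvgM; [exact: cvg_cst|exact: continuous_normal_pdf].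
  have Mh : exists M, forall y, cabs (h y) <= M.
    by have [M HM] := schwartz_bound 0 sh; exists M => y; have := HM y; rewrite expr0 mul1r.
  have [M HM] := Mh.
  have ihN : cintegrable (fun y => h y * (2 * pi * normal_pdf t e y)%:C).
    apply: (@dominated_cintegrable _ _ (fun y => M * (2 * pi) * normal_pdf t e y)).
    - by apply: cmeasurableM => //; case: wh.
    - exact: (integrableZl measurableT _ (integrable_normal_pdf t e)).
    - move=> y; rewrite cabsM cabs_real ger0_norm ?mulr_ge0 ?normal_pdf_ge0 //.
      rewrite [leRHS](_ : _ = M * (2 * pi * normal_pdf t e y)); last by ring.
      by rewrite ler_wpM2r ?mulr_ge0 ?normal_pdf_ge0.
  rewrite E -cintB //; last exact: cintegrableZ.
  have I2 := integrableZl measurableT (4 * pi * L * e) (integrable_normal_pdf t (2 * e)).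
  apply: le_trans (dominated_cint_le _ I2 _) _.
  - apply: cmeasurableB; apply: cmeasurableM => //; by case: wh.
  - move=> y; rewrite -mulrBl cabsM cabs_real ger0_norm ?mulr_ge0 ?normal_pdf_ge0 //.
    rewrite (normal_pdf_center t y en) (normal_pdf_center t y en2).
    apply: (@le_trans _ _ (2 * pi * L * (`|y - t| * normal_pdf 0 e (y - t)))).
      rewrite (_ : 2 * pi * L * _ = L * `|y - t| * (2 * pi * normal_pdf 0 e (y - t))); last by ring.
      by rewrite ler_wpM2r ?mulr_ge0 ?normal_pdf_ge0.
    rewrite (_ : 4 * pi * L * e * _ = 2 * pi * L * (2 * e * normal_pdf 0 (2 * e) (y - t))); last by ring.
    by rewrite ler_wpM2l ?mulr_ge0 // normal_pdf_first_moment.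
  by rewrite RintegralZl // ?Rintegral_normal_pdf ?mulr1 //; exact: integrable_normal_pdf.
apply/eqP; rewrite -subr_eq0 -cabs_eq0 eq_le cabs_ge0 andbT.
apply: (@le0_small _ _ (2 * K2 * weight_mass R + 8 * pi * L)) => e e0 e1.
have := first e e0 e1; rewrite ft_gauss_regularized // => F.
rewrite (_ : _ - _ = (ft 1 f t - cint (fun y => h y * (2 * pi * normal_pdf t e y)%:C)) +
  (cint (fun y => h y * (2 * pi * normal_pdf t e y)%:C) - (2 * pi)%:C * h t)); last by ring.
apply: le_trans (cabsD _ _) _; apply: le_trans (lerD F (second e e0)) _.
by rewrite le_eqVlt; apply/orP; left; apply/eqP; ring.
Qed.

(** A boundary value determines a distribution only on functions of the form [fourier g]; this makes
    it known on all test functions. *)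
Lemma fourier_schwartz_surjective h : schwartz h -> exists2 g, schwartz g & fourier g = h.
Proof.
move=> sh; exists (fun x => (2 * pi)^-1%:C * ft (-1) h x).
  by apply/schwartzZ/schwartz_ft => //; rewrite oppr_eq0 oner_eq0.
apply/funext => t; rewrite fourierE ftZ; last first.
  have sf : schwartz (ft (-1) h) by apply: schwartz_ft => //; rewrite oppr_eq0 oner_eq0.
  have [? w] := schwartz_weighted sf.
  exact: (weighted_cintegrable (ft_kernel_weighted _ _ w)).
rewrite ft_inversion // mulrA -rmorphM mulVf ?mul1r //.
by rewrite gt_eqF // mulr_gt0 // pi_gt0.
Qed.

End FourierInversion.
(** * Inverse Fourier-Laplace transforms of causal functions *)

Section CausalFunction.
Variable R : realType.
Local Notation C := R[i].
Local Notation mu := (@lebesgue_measure R).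
Implicit Types (g h : R -> C) (e s t x y v : R) (w : C).

Lemma exp_decay n v : 0 < v -> exists A : R, forall t, 0 <= t ->
  t ^+ n * expR (- (v * t)) <= A * weight t.
Proof.
move=> v0.
have pow m : exists A : R, forall t, 0 <= t -> t ^+ m * expR (- (v * t)) <= A.
  case: m => [|m].
    exists 1 => t t0; rewrite expr0 mul1r -expR0 ler_expR oppr_le0.
    by rewrite mulr_ge0 // ltW.
  exists ((m.+1)`!%:R / v ^+ m.+1) => t t0.
  rewrite expRN ler_pdivrMr ?expR_gt0 // mulrAC ler_pdivlMr ?exprn_gt0 //.
  rewrite -exprMn (mulrC t v); have vt : 0 <= v * t by rewrite mulr_ge0 // ltW.
  have := expR_ge1Dxn m vt => H.
  rewrite -ler_pdivrMl ?ltr0n ?fact_gt0 // [leLHS]mulrC.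
  by apply: le_trans H; rewrite lerDr.
have [A HA] := pow n; have [B HB] := pow n.+2.
exists (A + B) => t t0; apply: le_weight.
rewrite mulrDr mulr1 lerD ?HA //.
apply: le_trans (HB t t0).
have -> : t ^+ n.+2 = t ^+ n * t ^+ 2 by rewrite -exprD addn2.
by rewrite mulrAC lexx.
Qed.

Lemma ccontinuous_continuous g : ccontinuous g -> continuous (g : R -> C^o).
Proof.
move=> [c1 c2] x; apply/cvgrPdist_le => e e0.
(* The norm of [R[i]] takes values in [R[i]], and so does [e]; being positive, it is real. *)
have eE : e = (ReC e)%:C by apply/esym/RRe_real/gtr0_real.
have r0 : 0 < ReC e by move: e0; rewrite {1}eE ltcR.
have r2 : 0 < ReC e / 2 by rewrite divr_gt0.
have /cvgrPdist_le/(_ _ r2) n1 := c1 x.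
have /cvgrPdist_le/(_ _ r2) n2 := c2 x.
near=> y; rewrite -cabsC eE lecR.
apply: le_trans (cabs_le _) _; rewrite !ReImCE (splitr (ReC e)).
by apply: lerD; near: y.
Unshelve. all: by end_near. Qed.

Definition laplace_kernel w t : C := cexp (1 *i * w * t%:C).

Lemma laplace_kernelE w t :
  1 *i * w * t%:C = (- (ImC w * t))%:C + (ReC w * t)*i.
Proof. by apply: complex_eq; rewrite !ReImCE /=; ring. Qed.

Lemma cabs_laplace_kernel w t : cabs (laplace_kernel w t) = expR (- (ImC w * t)).
Proof. by rewrite cabs_cexp laplace_kernelE !ReImCE /= addr0. Qed.

Lemma ccontinuous_laplace_kernel w : ccontinuous (laplace_kernel w).
Proof.
apply: ccontinuous_cexp; apply: ccontinuousM; first exact: ccontinuous_cst.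
by apply: ccontinuous_real => x; exact: cvg_id.
Qed.

Variables (u : R -> C) (K : R).
Hypothesis u_continuous : ccontinuous u.
Hypothesis u_causal : forall t, t <= 0 -> u t = 0.
Hypothesis u_linear : forall t, cabs (u t) <= K * `|t|.

Definition function_dist (g : R -> C) : C := cint (fun t => u t * g t).

Let K_ge0 : 0 <= K.
Proof. by have := le_trans (cabs_ge0 _) (u_linear 1); rewrite normr1 mulr1. Qed.

Definition laplace w : C := cint (fun t => laplace_kernel w t * u t).

(** The growth of [u] costs one power of [t], so the decay of the exponential is used with exponent
    [n.+1]. *)
Lemma laplace_weighted n w : 0 < ImC w -> exists A : R,
  forall t, `|t| ^+ n * cabs (laplace_kernel w t * u t) <= A * weight t.
Proof.
move=> w0; have [A HA] := exp_decay n.+1 w0.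
exists (K * A) => t.
have [t0|t0] := leP t 0.
  have A0 : 0 <= A.
    have := HA 0 (lexx 0); rewrite expr0n mul0r.
    by rewrite pmulr_lge0 // weight_gt0.
  by rewrite u_causal // mulr0 cabs0 mulr0 !mulr_ge0 // weight_ge0.
rewrite cabsM cabs_laplace_kernel -mulrA.
apply: le_trans (ler_wpM2l K_ge0 (HA t (ltW t0))).
have := u_linear t; rewrite (gtr0_norm t0) => H.
rewrite exprSr (_ : K * _ = t ^+ n * (expR (- (ImC w * t)) * (K * t))); last by ring.
by rewrite !ler_wpM2l // ?expR_ge0 // exprn_ge0 // ltW.
Qed.

Lemma ccontinuous_laplace_integrand w : ccontinuous (fun t => laplace_kernel w t * u t).
Proof. by apply: ccontinuousM; first exact: ccontinuous_laplace_kernel. Qed.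

Lemma laplace_integrand_weighted w : 0 < ImC w ->
  exists A, weighted A (fun t => laplace_kernel w t * u t).
Proof.
move=> w0; have [A HA] := laplace_weighted 0 w0.
exists A; split; first exact/ccontinuous_measurable/ccontinuous_laplace_integrand.
by move=> t; have := HA t; rewrite expr0 mul1r.
Qed.

Lemma laplace_kernelD w z t :
  laplace_kernel (w + z) t = laplace_kernel w t * laplace_kernel z t.
Proof. by rewrite /laplace_kernel -cexpD; congr cexp; ring. Qed.

Lemma laplace_quadratic w : 0 < ImC w -> exists D B, forall z,
  cabs z <= ImC w / 2 ->
  cabs (laplace (w + z) - laplace w - z * D) <= B * cabs z ^+ 2.
Proof.
move=> w0.
have [A0 W0] := laplace_integrand_weighted w0.
have [A1 HA1] := laplace_weighted 1 w0.
have W1 : weighted A1 (fun t => 1 *i * t%:C * (laplace_kernel w t * u t)).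
  split.
    apply: cmeasurableM; last by case: W0.
    apply: ccontinuous_measurable; apply: ccontinuousM; first exact: ccontinuous_cst.
    by apply: ccontinuous_real => x; exact: cvg_id.
  move=> t; rewrite cabsM cabsM cabs_i normr1 mul1r cabs_real.
  by have := HA1 t; rewrite expr1.
(* For [|z| <= Im w / 2] the remainder of the kernel grows at most like [expR (Im w / 2 * t)]. Half
   of the decay is left, so the second moment is taken at height [Im w / 2]. *)
have wh : 0 < ImC ((ImC w / 2)*i) by rewrite /= divr_gt0.
have [A2 HA2] := laplace_weighted 2 wh.
exists (cint (fun t => 1 *i * t%:C * (laplace_kernel w t * u t))).
exists (2 * (4 * A2) * weight_mass R) => z zw.
have Imz : - ImC z <= ImC w / 2.
  by apply: le_trans zw; apply: le_trans (Im_le_cabs _); rewrite -normrN ler_norm.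
have wz : 0 < ImC (w + z) by rewrite ImCD; lra.
have [Az Wz] := laplace_integrand_weighted wz.
have i0 := weighted_cintegrable W0; have i1 := weighted_cintegrable W1.
have iz := weighted_cintegrable Wz.
have iD : cintegrable (fun t => laplace_kernel (w + z) t * u t - laplace_kernel w t * u t).
  exact: (weighted_cintegrable (weightedB Wz W0)).
rewrite /laplace -cintZ // -cintB // -cintB //; last exact: cintegrableZ.
rewrite (_ : _ * cabs z ^+ 2 = 2 * (4 * A2 * cabs z ^+ 2) * weight_mass R); last by ring.
have [mD _] := weightedB (weightedB Wz W0) (weightedZ z W1).
apply: weighted_cint_le; split => // t.
rewrite (_ : _ - _ = laplace_kernel w t * u t *
    (laplace_kernel z t - 1 - 1 *i * z * t%:C)); last first.
  by rewrite laplace_kernelD; ring.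
have [t0|t0] := leP t 0.
  have A20 : 0 <= A2.
    by have := HA2 0; rewrite normr0 expr0n mul0r pmulr_lge0 // weight_gt0.
  rewrite u_causal // mulr0 mul0r cabs0 mulr_ge0 ?weight_ge0 //.
  by rewrite mulr_ge0 ?sqr_ge0 // mulr_ge0.
rewrite cabsM [cabs (_ * u t)]cabsM cabs_laplace_kernel.
have Q := cexpB1Bid_le (1 *i * z * t%:C).
have Re_le : `|ReC (1 *i * z * t%:C)| <= ImC w / 2 * t.
  rewrite laplace_kernelE !ReImCE /= addr0 normrN normrM (gtr0_norm t0).
  by rewrite ler_pM2r // (le_trans (Im_le_cabs _)).
have ab : cabs (1 *i * z * t%:C) = cabs z * t.
  by rewrite !cabsM cabs_i cabs_real normr1 mul1r (gtr0_norm t0).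
rewrite ab in Q.
apply: le_trans (ler_wpM2l _ Q) _.
  by rewrite mulr_ge0 ?cabs_ge0 ?expR_ge0.
have := HA2 t; rewrite cabsM cabs_laplace_kernel /= (gtr0_norm t0) => H.
rewrite [leRHS](_ : _ = 4 * cabs z ^+ 2 * (A2 * weight t)); last by ring.
rewrite [leLHS](_ : _ = 4 * cabs z ^+ 2 * (t ^+ 2 * (expR (- (ImC w * t)) *
   expR `|ReC (1 *i * z * t%:C)| * cabs (u t)))); last by ring.
rewrite ler_wpM2l //; first by rewrite mulr_ge0 ?sqr_ge0.
apply: le_trans H; rewrite ler_wpM2l ?sqr_ge0 // ler_wpM2r ?cabs_ge0 //.
by rewrite -expRD ler_expR; lra.
Qed.

Lemma derivable_quadratic (F : C -> C) (w D : C) (B d : R) : 0 < d ->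
  (forall z, cabs z <= d -> cabs (F (w + z) - F w - z * D) <= B * cabs z ^+ 2) ->
  derivable (F : C^o -> C^o) w 1.
Proof.
move=> d0 H; have B0 : 0 <= B.
  have := le_trans (cabs_ge0 _) (H d%:C _); rewrite cabs_real gtr0_norm //.
  by move=> /(_ (lexx _)); rewrite pmulr_lge0 // exprn_gt0.
apply/cvg_ex; exists D; apply/cvgrPdist_le => e e0.
have eE : e = (ReC e)%:C by apply/esym/RRe_real/gtr0_real.
have r0 : 0 < ReC e by move: e0; rewrite {1}eE ltcR.
near=> h.
have h0 : h != 0 by near: h; exact: nbhs_dnbhs_neq.
have h1 : `|h| <= d%:C.
  by near: h; apply: dnbhs0_le; rewrite ltcR.
have h2 : `|h| <= (ReC e / (B + 1))%:C.
  by near: h; apply: dnbhs0_le; rewrite ltcR divr_gt0 // ltr_wpDl.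
move: h1 h2; rewrite -!cabsC !lecR => h1 h2; rewrite [leRHS]eE lecR.
rewrite /GRing.scale /= mulr1 (addrC h w) cabsBC.
have -> : h^-1 * (F (w + h) - F w) - D = h^-1 * (F (w + h) - F w - h * D).
  by rewrite [in RHS]mulrBr mulKf.
rewrite cabsM cabsV ler_pdivrMl ?cabs_gt0 //.
apply: le_trans (H h h1) _; rewrite expr2 mulrCA.
rewrite ler_wpM2l ?cabs_ge0 //.
move: h2; rewrite ler_pdivlMr ?ltr_wpDl // => h2.
by apply: le_trans h2; rewrite mulrC ler_wpM2l ?cabs_ge0 // lerDl.
Unshelve. all: by end_near. Qed.

(** The powers 1 and 3 are those of [|t| (1 + t^2)], the growth of [u] times the inverse of the
    weight; hence the order 3 in [function_dist_tempered]. *)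
Lemma function_dist_weighted g M :
  schwartz g -> (forall x, `|x| * cabs (g x) <= M) ->
  (forall x, `|x| ^+ 3 * cabs (g x) <= M) ->
  weighted (2 * K * M) (fun t => u t * g t).
Proof.
move=> sg H1 H3; split.
  by apply/ccontinuous_measurable/ccontinuousM => //; exact: schwartz_continuous.
move=> x; apply: le_weight; rewrite cabsM.
have := u_linear x; have := cabs_ge0 (g x) => g0 ux.
apply: (@le_trans _ _ (K * `|x| * cabs (g x) * (1 + x ^+ 2))).
  by rewrite ler_wpM2r ?(ltW (weight_den_gt0 _)) // ler_wpM2r.
rewrite (_ : _ * _ = K * (`|x| * cabs (g x) + `|x| ^+ 3 * cabs (g x))); last first.
  by rewrite -(real_normK (num_real x)); ring.
rewrite (_ : 2 * K * M = K * (2 * M)); last by ring.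
by rewrite ler_wpM2l //; have := H1 x; have := H3 x; lra.
Qed.

Lemma schwartz_function_dist_weighted g : schwartz g ->
  exists A, weighted A (fun t => u t * g t).
Proof.
move=> sg; have [M1 H1] := schwartz_bound 1 sg; have [M3 H3] := schwartz_bound 3 sg.
exists (2 * K * Num.max M1 M3).
apply: function_dist_weighted => // x; rewrite le_max.
  by have := H1 x; rewrite expr1 => ->.
by rewrite H3 orbT.
Qed.

Lemma function_dist_cintegrable g : schwartz g -> cintegrable (fun t => u t * g t).
Proof. by move=> /schwartz_function_dist_weighted[A]; exact: weighted_cintegrable. Qed.

Lemma function_dist_tempered : tempered function_dist.
Proof.
split=> [a g h sg sh|].
  have ig := function_dist_cintegrable sg; have ih := function_dist_cintegrable sh.
  rewrite /function_dist -cintZ // -cintD //; last exact: cintegrableZ.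
  by apply: eq_cint => t; ring.
exists 3%N, (4 * K * weight_mass R) => g M sg H.
have H0 j x : (j <= 3)%N -> `|x| ^+ j * cabs (g x) <= M.
  move=> j3; have := H j 0%N j3 (leq0n _) x.
  by rewrite (_ : cderiven 0 g x = g x) //; apply: complex_eq.
have /weighted_cint_le : weighted (2 * K * M) (fun t => u t * g t).
  by apply: function_dist_weighted => // x; [have := H0 1%N x isT; rewrite expr1|exact: H0].
by move=> /le_trans; apply; rewrite le_eqVlt; apply/orP; left; apply/eqP; ring.
Qed.

Lemma function_dist_supported : supported_nonneg function_dist.
Proof.
move=> g a b _ b0 gab; rewrite /function_dist -[RHS](@cint0 R).
apply: eq_cint => x; have [x0|x0] := leP x 0; first by rewrite u_causal // mul0r.
by rewrite gab ?mulr0 // negb_and -!ltNge (lt_trans b0 x0) orbT.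
Qed.

(** * Boundary value of the Laplace integral *)

Section BoundaryValue.
Variable g : R -> C.
Hypothesis sg : schwartz g.

Let Gxt e (z : R * R) : C := laplace_kernel (z.1 +i* e) z.2 * u z.2 * g z.1.

Let mGxt e : cmeasurable (Gxt e).
Proof.
have m1 : measurable_fun setT (fun z : R * R => z.1) by exact: measurable_fst.
have m2 : measurable_fun setT (fun z : R * R => z.2) by exact: measurable_snd.
apply: cmeasurableM; first apply: cmeasurableM.
- apply: cmeasurable_cexp; apply: cmeasurableM; last exact: cmeasurable_real.
  apply: cmeasurableM; first exact: cmeasurable_cst.
  by split => //=; exact: measurable_cst.
- exact: (@cmeasurable_comp _ _ _ _ _ u snd (ccontinuous_measurable u_continuous) m2).
- have cg := ccontinuous_measurable (schwartz_continuous sg).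
  exact: (@cmeasurable_comp _ _ _ _ _ g fst cg m1).
Qed.

Let Gxt_le e : 0 < e -> exists A, forall x t,
  cabs (Gxt e (x, t)) <= A * weight x * weight t.
Proof.
move=> e0; have [L [_ Lg]] := schwartz_weighted sg.
have [A [_ HA]] := @laplace_integrand_weighted (e *i) e0.
exists (L * A) => x t.
rewrite /Gxt /= cabsM [cabs (_ * u t)]cabsM cabs_laplace_kernel /=.
rewrite (_ : L * A * _ * _ = (A * weight t) * (L * weight x)); last by ring.
rewrite ler_pM ?mulr_ge0 ?cabs_ge0 ?expR_ge0 //.
by have := HA t; rewrite cabsM cabs_laplace_kernel.
Qed.

Lemma laplace_line_cintegrable e : 0 < e ->
  cintegrable (fun x => laplace (x +i* e) * g x).
Proof.
move=> e0; have [A HA] := Gxt_le e0.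
have E x : laplace (x +i* e) * g x = cint (fun t => Gxt e (x, t)).
  have [B WB] := @laplace_integrand_weighted (x +i* e) e0.
  rewrite /laplace mulrC -cintZ; last exact: (weighted_cintegrable WB).
  by apply: eq_cint => t; rewrite /Gxt /= mulrC.
rewrite (_ : (fun x => _) = (fun x => cint (fun t => Gxt e (x, t)))); last exact/funext.
apply: (weighted_cintegrable (K := 2 * A * weight_mass R)); split.
  exact: cmeasurable_cint (mGxt e) HA.
move=> x; have : weighted (A * weight x) (fun t => Gxt e (x, t)).
  split; last exact: HA.
  have mp : measurable_fun setT (fun t : R => (x, t)) by exact: pair1_measurable.
  exact: (@cmeasurable_comp _ _ _ _ _ (Gxt e) (fun t => (x, t)) (mGxt e) mp).
move=> /weighted_cint_le/le_trans; apply.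
by rewrite le_eqVlt; apply/orP; left; apply/eqP; ring.
Qed.

(** Once the integrals are exchanged, the one over [x] is the Fourier transform of [g], and the
    height [e] survives only as an Abel factor. *)
Lemma laplace_line_cint e : 0 < e ->
  cint (fun x => laplace (x +i* e) * g x) =
  cint (fun t => u t * ((expR (- (e * t)))%:C * fourier g t)).
Proof.
move=> e0; have [A HA] := Gxt_le e0.
transitivity (cint (fun x => cint (fun t => Gxt e (x, t)))).
  apply: eq_cint => x; have [B WB] := @laplace_integrand_weighted (x +i* e) e0.
  rewrite /laplace mulrC -cintZ; last exact: (weighted_cintegrable WB).
  by apply: eq_cint => t; rewrite /Gxt /= mulrC.
rewrite (cint_Fubini (mGxt e) HA); apply: eq_cint => t.
have [L wg] := schwartz_weighted sg.
have i1 := weighted_cintegrable (ft_kernel_weighted 1 t wg).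
rewrite fourierE /ft mulrA -cintZ //.
apply: eq_cint => x; rewrite /Gxt /laplace_kernel laplace_kernelE /= cexpD mul1r.
rewrite (_ : cexp (- (e * t))%:C = (expR (- (e * t)))%:C); first by ring.
by apply: complex_eq; rewrite /cexp /= cos0 sin0; ring.
Qed.

Lemma laplace_line_rate : exists B, forall e, 0 < e ->
  cabs (function_dist (fourier g) - cint (fun x => laplace (x +i* e) * g x)) <= B * e.
Proof.
have sf : schwartz (fourier g).
  by rewrite fourierE; apply: schwartz_ft => //; exact: oner_neq0.
(* Two powers of [t] have to be absorbed: one from [|1 - exp (- e t)| <= e t], one from the growth
   of [u]. *)
have [L [_ HL]] := schwartz_weighted (schwartz_mulx (schwartz_mulx sf)).
have cf := schwartz_continuous sf.
have [W w1] := schwartz_function_dist_weighted sf.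
exists (2 * (K * L) * weight_mass R) => e e0.
have w2 : weighted W (fun t => u t * ((expR (- (e * t)))%:C * fourier g t)).
  split.
    apply: ccontinuous_measurable; apply: ccontinuousM => //; apply: ccontinuousM => //.
    apply: ccontinuous_real => x.
    apply: (@continuous_comp _ _ _ (fun t => - (e * t)) expR); last exact: continuous_expR.
    by apply: cvgN; exact: continuous_scale.
  move=> t; have [t0|t0] := leP t 0.
    by rewrite u_causal // mul0r cabs0 mulr_ge0 ?weight_ge0 // (weighted_ge0 w1).
  apply: le_trans (w1.2 t); rewrite mulrCA [leLHS]cabsM cabs_real ger0_norm ?expR_ge0 //.
  rewrite ler_piMl ?cabs_ge0 // -expR0 ler_expR oppr_le0 mulr_ge0 // ltW //.
rewrite laplace_line_cint // /function_dist -cintB; last 2 first.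
- exact: (weighted_cintegrable w1).
- exact: (weighted_cintegrable w2).
rewrite (_ : _ * e = 2 * (K * L * e) * weight_mass R); last by ring.
apply: weighted_cint_le; split; first by apply: cmeasurableB; [case: w1|case: w2].
move=> t; have L0 : 0 <= L.
  by have := le_trans (cabs_ge0 _) (HL 0); rewrite pmulr_lge0 // weight_gt0.
have [t0|t0] := leP t 0.
  rewrite u_causal // !mul0r subr0 cabs0 mulr_ge0 ?weight_ge0 //.
  by rewrite mulr_ge0 ?(ltW e0) // mulr_ge0.
rewrite (_ : _ - _ = (1 - expR (- (e * t)))%:C * u t * fourier g t); last first.
  by rewrite rmorphB rmorph1; ring.
rewrite cabsM [cabs (_ * u t)]cabsM cabs_real.
have et : `|1 - expR (- (e * t))| <= e * t.
  have := expR_ge1Dx (- (e * t)) => h1.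
  have h2 : expR (- (e * t)) <= 1.
    by rewrite -expR0 ler_expR oppr_le0 mulr_ge0 // ltW.
  by rewrite ger0_norm; lra.
have ut := u_linear t; rewrite (gtr0_norm t0) in ut.
have := HL t; rewrite cabsM [cabs (_ * fourier g t)]cabsM cabs_real (gtr0_norm t0) => H.
apply: (@le_trans _ _ (e * t * (K * t) * cabs (fourier g t))).
  by rewrite ler_wpM2r ?cabs_ge0 // ler_pM ?cabs_ge0.
rewrite [leLHS](_ : _ = K * e * (t * (t * cabs (fourier g t)))); last by ring.
rewrite [leRHS](_ : _ = K * e * (L * weight t)); last by ring.
by rewrite ler_wpM2l // mulr_ge0 // ltW.
Qed.

End BoundaryValue.

Lemma cvg_at_right_rate (S : R -> C) (l : C) (B : R) :
  (forall e, 0 < e -> cabs (l - S e) <= B * e) ->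
  (S : R -> C^o) @ 0^'+ --> (l : C^o).
Proof.
move=> H; apply/cvgrPdist_le => e e0.
have eE : e = (ReC e)%:C by apply/esym/RRe_real/gtr0_real.
have r0 : 0 < ReC e by move: e0; rewrite {1}eE ltcR.
have B1 : 0 < `|B| + 1 by rewrite ltr_wpDl.
near=> d; rewrite -cabsC eE lecR.
have d0 : 0 < d by near: d; exact: nbhs_right_gt.
have d1 : d <= ReC e / (`|B| + 1).
  by near: d; apply: nbhs_right_le; rewrite divr_gt0.
apply: le_trans (H d d0) _; move: d1; rewrite ler_pdivlMr // => d1.
have := ler_norm B; nra.
Unshelve. all: by end_near. Qed.

Theorem causal_inverse_FL (F : C -> C) :
  (forall w, 0 < ImC w -> F w = laplace w) ->
  (exists T, inverse_FL F T) /\ forall T, inverse_FL F T -> is_function T u.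
Proof.
move=> FE.
have lineE e g : 0 < e ->
    (fun x => F (x +i* e) * g x) = (fun x => laplace (x +i* e) * g x).
  by move=> e0; apply/funext => x; rewrite FE.
have boundary g : schwartz g ->
    (fun e : R => (cint (fun x => F (x +i* e) * g x) : C^o)) @ 0^'+
    --> (function_dist (fourier g) : C^o).
  move=> sg; have [B HB] := laplace_line_rate sg.
  by apply: (cvg_at_right_rate (B := B)) => e e0; rewrite lineE // HB.
split.
  exists function_dist; split.
  - exact: function_dist_tempered.
  - exact: function_dist_supported.
  split=> [w w0|g sg]; last first.
    split; last exact: boundary.
    by move=> e e0; rewrite lineE //; exact: laplace_line_cintegrable.
  have [D [B HB]] := laplace_quadratic w0.
  apply: (@derivable_quadratic F w D B (ImC w / 2)); first by rewrite divr_gt0.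
  (* For [|z| <= Im w / 2] the point [w + z] stays in the upper half-plane, where [F] is the Laplace
     integral. *)
  move=> z zw; rewrite !FE ?HB // ImCD.
  have := le_trans (Im_le_cabs z) zw; rewrite ler_norml => /andP[+ _].
  by move: w0; rewrite /upper_half_plane /=; lra.
move=> T [_ _ [_ bT]]; split; first exact: ccontinuous_continuous.
move=> h sh; have [g sg gh] := fourier_schwartz_surjective sh.
split; first exact: function_dist_cintegrable.
(* With [h = fourier g], both [T h] and [function_dist h] are limits of the same integrals of [F]
   along horizontal lines. *)
have [_ cT] := bT g sg.
rewrite -gh.
have H : hausdorff_space (R[i]^o) by exact: norm_hausdorff.
exact: (cvg_unique H cT (boundary g sg)).
Qed.

End CausalFunction.
(** * The hyperbolic cotangent on horizontal lines *)

Section HyperbolicLines.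
Variable R : realType.
Local Notation C := R[i].
Implicit Types (x y : R).

Definition rsinh x : R := (expR x - expR (- x)) / 2.

Lemma rcosh_sqr x : rcosh x ^+ 2 = rsinh x ^+ 2 + 1.
Proof.
have : expR x * expR (- x) = 1 by rewrite -expRD subrr expR0.
rewrite /rcosh /rsinh => E.
apply/eqP; rewrite -subr_eq0; apply/eqP.
transitivity (expR x * expR (- x) - 1); first by field.
by rewrite E subrr.
Qed.

Lemma csinhE x y : csinh (x +i* y) = (rsinh x * cos y) +i* (rcosh x * sin y).
Proof.
rewrite /csinh /cexp /rsinh /rcosh [in ReC (- _)]/= [in ImC (- _)]/= cosN sinN.
rewrite -[2 : C](rmorph_nat (real_complex R)) -fmorphV.
by apply: complex_eq; rewrite !ReImCE /=; ring.
Qed.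

Lemma ccoshE x y : ccosh (x +i* y) = (rcosh x * cos y) +i* (rsinh x * sin y).
Proof.
rewrite /ccosh /cexp /rsinh /rcosh [in ReC (- _)]/= [in ImC (- _)]/= cosN sinN.
rewrite -[2 : C](rmorph_nat (real_complex R)) -fmorphV.
by apply: complex_eq; rewrite !ReImCE /=; ring.
Qed.

Lemma sqr_cabs_csinh x y : cabs (csinh (x +i* y)) ^+ 2 = rsinh x ^+ 2 + sin y ^+ 2.
Proof.
rewrite sqr_cabs csinhE /=.
transitivity (rsinh x ^+ 2 * cos y ^+ 2 + rcosh x ^+ 2 * sin y ^+ 2); first by ring.
rewrite rcosh_sqr.
transitivity (rsinh x ^+ 2 * (cos y ^+ 2 + sin y ^+ 2) + sin y ^+ 2); first by ring.
by rewrite cos2Dsin2 mulr1.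
Qed.

Lemma sqr_cabs_ccosh x y : cabs (ccosh (x +i* y)) ^+ 2 = rsinh x ^+ 2 + cos y ^+ 2.
Proof.
rewrite sqr_cabs ccoshE /=.
transitivity (rcosh x ^+ 2 * cos y ^+ 2 + rsinh x ^+ 2 * sin y ^+ 2); first by ring.
rewrite rcosh_sqr.
transitivity (rsinh x ^+ 2 * (cos y ^+ 2 + sin y ^+ 2) + cos y ^+ 2); first by ring.
by rewrite cos2Dsin2 mulr1.
Qed.

Lemma csinh_neq0 x y : sin y != 0 -> csinh (x +i* y) != 0.
Proof.
move=> s0; rewrite -cabs_eq0 -sqrf_eq0 sqr_cabs_csinh gt_eqF //.
by rewrite ltr_wpDl ?sqr_ge0 // exprn_even_gt0.
Qed.

(** With [S = rsinh x], this is [(S^2 + cos^2 y) sin^2 y <= S^2 + sin^2 y]. *)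
Lemma cabs_ccoth_le x y : sin y != 0 -> cabs (ccoth (x +i* y)) <= `|sin y|^-1.
Proof.
move=> s0; have sp : 0 < `|sin y| by rewrite normr_gt0.
have cp : 0 < cabs (csinh (x +i* y)) by rewrite cabs_gt0 csinh_neq0.
rewrite /ccoth cabsM cabsV ler_pdivrMr // ler_pdivlMl //.
rewrite -ler_sqr ?nnegrE ?mulr_ge0 ?cabs_ge0 //.
rewrite exprMn sqr_cabs_csinh sqr_cabs_ccosh real_normK ?num_real //.
have := cos2Dsin2 y; have := sqr_ge0 (rsinh x); have := sqr_ge0 (sin y).
have := sqr_ge0 (cos y); nra.
Qed.

Lemma rcosh_continuous : continuous (@rcosh R).
Proof.
move=> x; rewrite /rcosh; apply: cvgM; last exact: cvg_cst.
apply: cvgD; first exact: continuous_expR.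
apply: (@continuous_comp _ _ _ -%R expR); last exact: continuous_expR.
exact: opp_continuous.
Qed.

Lemma rsinh_continuous : continuous rsinh.
Proof.
move=> x; rewrite /rsinh; apply: cvgM; last exact: cvg_cst.
apply: cvgB; first exact: continuous_expR.
apply: (@continuous_comp _ _ _ -%R expR); last exact: continuous_expR.
exact: opp_continuous.
Qed.

Lemma ccontinuous_ccoth_line y : sin y != 0 ->
  ccontinuous (fun x => ccoth (x +i* y)).
Proof.
move=> s0; rewrite /ccoth; apply: ccontinuousM.
  have -> : (fun x => ccosh (x +i* y)) = (fun x => (rcosh x * cos y) +i* (rsinh x * sin y)).
    by apply/funext => x; rewrite ccoshE.
  split=> /= x; apply: cvgM; try exact: cvg_cst.
    exact: rcosh_continuous.
  exact: rsinh_continuous.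
apply: ccontinuousV => [x|]; first exact: csinh_neq0.
have -> : (fun x => csinh (x +i* y)) = (fun x => (rsinh x * cos y) +i* (rcosh x * sin y)).
  by apply/funext => x; rewrite csinhE.
split=> /= x; apply: cvgM; try exact: cvg_cst.
  exact: rsinh_continuous.
exact: rcosh_continuous.
Qed.

(** [1 + x^2 <= 4 (1 + |x| / 2)^2 <= 4 expR |x| <= 8 cosh x], the middle inequality by squaring
    [1 + y <= expR y] at [y = |x| / 2]. *)
Lemma rcosh_ge x : 1 + x ^+ 2 <= 8 * rcosh x.
Proof.
have E : expR `|x| <= 2 * rcosh x.
  rewrite /rcosh mulrC divfK //.
  have [x0|x0] := leP 0 x; first by rewrite ger0_norm // lerDl expR_ge0.
  by rewrite ltr0_norm // lerDr expR_ge0.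
have H : (1 + `|x| / 2) ^+ 2 <= expR `|x|.
  have -> : expR `|x| = expR (`|x| / 2) ^+ 2 by rewrite expr2 -expRD -splitr.
  by rewrite ler_sqr ?nnegrE ?expR_ge0 ?expR_ge1Dx // addr_ge0 // divr_ge0.
have := normr_ge0 x; rewrite -(real_normK (num_real x)); nra.
Qed.

Lemma rcosh_gt0 x : 0 < rcosh x.
Proof. by have := rcosh_ge x; have := sqr_ge0 x; lra. Qed.

End HyperbolicLines.

(** * The Laplace transform of the diffracted wave *)

Section DiffractedWave.
Variable R : realType.
Local Notation C := R[i].
Local Notation mu := (@lebesgue_measure R).
Implicit Types (t b x : R) (w : C).
Variables (omega0 rho : R) (f Z : R -> C) (F M : R).
Hypothesis rho_gt0 : 0 < rho.
Hypothesis f_causal : forall s : R, s <= 0 -> f s = 0.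
Hypothesis f_le : forall s, cabs (f s) <= F.
Hypothesis f_continuous : ccontinuous f.
Hypothesis Z_le : forall b, cabs (Z b) <= M.
Hypothesis Z_continuous : ccontinuous Z.

Definition wave_integrand t b : C :=
  cexp ((omega0 * rho * rcosh b)*i) * Z b * f (t - rho * rcosh b).

Definition wave_amplitude t : C := cint (wave_integrand t).

Let F0 : 0 <= F. Proof. exact: le_trans (cabs_ge0 _) (f_le 0). Qed.
Let M0 : 0 <= M. Proof. exact: le_trans (cabs_ge0 _) (Z_le 0). Qed.

Let c0 : 0 <= M * F * (8 / rho).
Proof. by apply: mulr_ge0; [exact: mulr_ge0|rewrite divr_ge0 ?ler0n // ltW]. Qed.

Let continuous_phase : continuous (fun b => rho * rcosh b).
Proof. by move=> x; apply: cvgM; [exact: cvg_cst|exact: rcosh_continuous]. Qed.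

(* The factor [f (t - rho cosh b)] vanishes unless [rho cosh b < t], and there
   [1 <= 8 t / (rho (1 + b^2))]. *)
Lemma cabs_wave_integrand t b :
  cabs (wave_integrand t b) <= M * F * (8 / rho) * `|t| * weight b.
Proof.
have [tb|bt] := leP t (rho * rcosh b).
  rewrite /wave_integrand f_causal ?subr_le0 // mulr0 cabs0.
  by rewrite mulr_ge0 ?weight_ge0 // mulr_ge0.
have t0 : 0 < t by apply: lt_trans bt; rewrite mulr_gt0 // rcosh_gt0.
rewrite /wave_integrand cabsM [cabs (_ * Z b)]cabsM cabs_cexp_i mul1r.
rewrite (gtr0_norm t0) (_ : _ * weight b = M * F * (8 / rho * t * weight b)); last by ring.
apply: (@le_trans _ _ (M * F)); first by rewrite ler_pM ?cabs_ge0.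
rewrite ler_peMr ?mulr_ge0 //; apply: le_weight; rewrite mul1r.
rewrite mulrAC ler_pdivlMr // mulrC.
have := rcosh_ge b; nra.
Qed.

Lemma ccontinuous_wave_integrand t : ccontinuous (wave_integrand t).
Proof.
apply: ccontinuousM; first apply: ccontinuousM => //.
  apply: ccontinuous_cexp; apply: ccontinuous_i => x.
  by apply: cvgM; [exact: cvg_cst|exact: rcosh_continuous].
apply: ccontinuous_comp => // x.
by apply: cvgB; [exact: cvg_cst|exact: continuous_phase].
Qed.

Lemma wave_integrand_weighted t :
  weighted (M * F * (8 / rho) * `|t|) (wave_integrand t).
Proof.
split; first exact/ccontinuous_measurable/ccontinuous_wave_integrand.
exact: cabs_wave_integrand.
Qed.

Lemma wave_amplitude_causal t : t <= 0 -> wave_amplitude t = 0.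
Proof.
move=> t0; rewrite /wave_amplitude -[RHS](@cint0 R); apply: eq_cint => b.
rewrite /wave_integrand f_causal ?mulr0 // subr_le0 (le_trans t0) //.
by rewrite mulr_ge0 ?ltW // rcosh_gt0.
Qed.

Lemma wave_amplitude_linear t :
  cabs (wave_amplitude t) <= 2 * (M * F * (8 / rho)) * weight_mass R * `|t|.
Proof.
apply: le_trans (weighted_cint_le (wave_integrand_weighted t)) _.
by rewrite le_eqVlt; apply/orP; left; apply/eqP; ring.
Qed.

(** The majorant of the integrand grows with [t], so domination is used on the unit neighbourhood of
    each point. *)
Lemma wave_amplitude_continuous : ccontinuous wave_amplitude.
Proof.
have bnd (a x b : R) : x \in `]a - 1, a + 1[ ->
    cabs (wave_integrand x b) <= M * F * (8 / rho) * (`|a| + 1) * weight b.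
  rewrite in_itv /= => /andP[x1 x2]; apply: le_trans (cabs_wave_integrand _ _) _.
  rewrite ler_wpM2r ?weight_ge0 // ler_wpM2l //.
  have -> : x = a + (x - a) by ring.
  apply: le_trans (ler_normD _ _) _; rewrite lerD2l ler_norml; lra.
have ct b : ccontinuous (fun x => wave_integrand x b).
  apply: ccontinuousM; first exact: ccontinuous_cst.
  by apply: ccontinuous_comp => // x; apply: cvgB; [exact: cvg_id|exact: cvg_cst].
have ai (a : R) : a \in `]a - 1, a + 1[ by rewrite in_itv /=; lra.
split=> a.
  apply: (@continuity_under_integral _ _ _ mu (fun x b => ReC (wave_integrand x b))
    setT measurableT (a - 1) (a + 1) _ _ (fun b => M * F * (8 / rho) * (`|a| + 1) * weight b)).
  - by move=> x _; case: (weighted_cintegrable (wave_integrand_weighted x)).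
  - by apply: aeW => b _ x _; case: (ct b).
  - exact: integrable_cst_weight.
  - move=> x xI; apply: aeW => b _; apply: le_trans (Re_le_cabs _) _.
    by apply: bnd; exact: xI.
  - by apply/mem_set; exact: ai.
apply: (@continuity_under_integral _ _ _ mu (fun x b => ImC (wave_integrand x b))
    setT measurableT (a - 1) (a + 1) _ _ (fun b => M * F * (8 / rho) * (`|a| + 1) * weight b)).
- by move=> x _; case: (weighted_cintegrable (wave_integrand_weighted x)).
- by apply: aeW => b _ x _; case: (ct b).
- exact: integrable_cst_weight.
- move=> x xI; apply: aeW => b _; apply: le_trans (Im_le_cabs _) _.
  by apply: bnd; exact: xI.
- by apply/mem_set; exact: ai.
Qed.

(** With [v = Im w * rho * cosh b], [expR (- v) <= 1 / v], and [1 + b^2 <= 8 cosh b] gives the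
    constant. *)
Lemma laplace_kernel_phase_weighted w : 0 < ImC w ->
  weighted (8 / (ImC w * rho)) (fun b => laplace_kernel w (rho * rcosh b)).
Proof.
move=> w0; split.
  apply: ccontinuous_measurable; apply: ccontinuous_comp => //.
  exact: ccontinuous_laplace_kernel.
move=> b; rewrite cabs_laplace_kernel; apply: le_weight.
have vr : 0 < ImC w * rho by rewrite mulr_gt0.
rewrite expRN ler_pdivrMl ?expR_gt0 // [leRHS]mulrA ler_pdivlMr //.
have h1 := expR_ge1Dx (ImC w * (rho * rcosh b)).
have h2 := rcosh_ge b; have h3 := rcosh_gt0 b.
apply: (@le_trans _ _ (8 * (1 + ImC w * (rho * rcosh b)))); last by rewrite mulrC ler_wpM2r.
nra.
Qed.

Lemma g_hat_integrand_weighted w : 0 < ImC w -> exists A : R,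
  weighted A (fun s => cexp (1 *i * w * s%:C) * cexp ((- (omega0 * s))*i) * f s).
Proof.
move=> w0; have [A HA] := exp_decay 0 w0.
exists (F * A); split.
  apply: ccontinuous_measurable; apply: ccontinuousM => //; apply: ccontinuousM.
    exact: ccontinuous_laplace_kernel.
  apply: ccontinuous_cexp; apply: ccontinuous_i => x.
  by apply: cvgN; exact: continuous_scale.
move=> s; have A0 : 0 <= A * weight 0.
  by apply: le_trans (HA 0 (lexx 0)); rewrite expr0 mul1r expR_ge0.
have {}A0 : 0 <= A by move: A0; rewrite pmulr_lge0 ?weight_gt0.
have [s0|s0] := leP s 0.
  by rewrite f_causal // mulr0 cabs0 mulr_ge0 ?weight_ge0 // mulr_ge0.
rewrite -/(laplace_kernel w s) cabsM [cabs (laplace_kernel _ _ * _)]cabsM.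
rewrite cabs_laplace_kernel cabs_cexp_i mulr1 mulrC -mulrA.
rewrite ler_pM ?cabs_ge0 ?expR_ge0 //.
by have := HA s (ltW s0); rewrite expr0 mul1r.
Qed.

(** Put [p = rho cosh b]. The factor [exp (i omega0 p)] of the integrand turns [exp (- i omega0 t)]
    into [exp (- i omega0 (t - p))], so the integral over [t] is that of [g_hat] shifted by [p],
    times [exp (i w p)]. *)
Lemma laplace_wave w : 0 < ImC w ->
  cint (fun t => laplace_kernel w t * (cexp ((- (omega0 * t))*i) * wave_amplitude t)) =
  g_hat omega0 f w * cint (fun b => laplace_kernel w (rho * rcosh b) * Z b).
Proof.
move=> w0.
pose G (z : R * R) : C := laplace_kernel w z.1 * cexp ((- (omega0 * z.1))*i) *
  (cexp ((omega0 * rho * rcosh z.2)*i) * Z z.2 * f (z.1 - rho * rcosh z.2)).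
have mG : cmeasurable G.
  have m1 : measurable_fun setT (fun z : R * R => z.1) by exact: measurable_fst.
  have m2 : measurable_fun setT (fun z : R * R => z.2) by exact: measurable_snd.
  have mc : measurable_fun setT (fun z : R * R => rcosh z.2).
    by apply: (measurableT_comp _ m2); apply: continuous_measurable_fun; exact: rcosh_continuous.
  apply: cmeasurableM; first apply: cmeasurableM.
  - exact: (@cmeasurable_comp _ _ _ _ _ (laplace_kernel w) fst
      (ccontinuous_measurable (ccontinuous_laplace_kernel w)) m1).
  - apply: cmeasurable_cexp; apply: cmeasurable_i; apply: measurableT_comp => //.
    exact: measurable_funM.
  apply: cmeasurableM; first apply: cmeasurableM.
  - by apply: cmeasurable_cexp; apply: cmeasurable_i; exact: measurable_funM.
  - exact: (@cmeasurable_comp _ _ _ _ _ Z snd (ccontinuous_measurable Z_continuous) m2).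
  apply: (@cmeasurable_comp _ _ _ _ _ f (fun z : R * R => z.1 - rho * rcosh z.2)
    (ccontinuous_measurable f_continuous)).
  by apply: measurable_funB => //; exact: measurable_funM.
have [A HA] := exp_decay 1 w0.
have A0 : 0 <= A by have := HA 0 (lexx 0); rewrite expr1 mul0r pmulr_lge0 ?weight_gt0.
have GK t b : cabs (G (t, b)) <= M * F * (8 / rho) * A * weight t * weight b.
  rewrite /G /= -/(wave_integrand t b).
  have [t0|t0] := leP t 0.
    rewrite /wave_integrand f_causal; last first.
      by rewrite subr_le0 (le_trans t0) // mulr_ge0 ?ltW // rcosh_gt0.
    rewrite !mulr0 cabs0 mulr_ge0 ?weight_ge0 // mulr_ge0 ?weight_ge0 //.
    by rewrite mulr_ge0.
  rewrite cabsM [cabs (laplace_kernel _ _ * _)]cabsM cabs_laplace_kernel cabs_cexp_i mulr1.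
  apply: le_trans (ler_wpM2l (expR_ge0 _) (cabs_wave_integrand t b)) _.
  rewrite (gtr0_norm t0).
  rewrite [leLHS](_ : _ = M * F * (8 / rho) * (t ^+ 1 * expR (- (ImC w * t))) * weight b); last by ring.
  by rewrite ler_wpM2r ?weight_ge0 // -[leRHS]mulrA ler_wpM2l // HA // ltW.
transitivity (cint (fun t => cint (fun b => G (t, b)))).
  apply: eq_cint => t; rewrite /wave_amplitude mulrA -cintZ //.
  exact: (weighted_cintegrable (wave_integrand_weighted t)).
rewrite (cint_Fubini mG GK).
have [B wB] := g_hat_integrand_weighted w0.
have cB : ccontinuous (fun s => cexp (1 *i * w * s%:C) * cexp ((- (omega0 * s))*i) * f s).
  apply: ccontinuousM => //; apply: ccontinuousM.
    exact: ccontinuous_laplace_kernel.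
  apply: ccontinuous_cexp; apply: ccontinuous_i => x.
  by apply: cvgN; exact: continuous_scale.
rewrite -cintZ; last first.
  have := weightedM (ccontinuous_measurable Z_continuous) Z_le (laplace_kernel_phase_weighted w0).
  move=> /weighted_cintegrable; congr cintegrable; apply/funext => b; exact: mulrC.
apply: eq_cint => b; rewrite /g_hat -(cint_shift (- (rho * rcosh b)) cB wB).
rewrite mulrC -cintZ; last first.
  have [H1 H2] := wB; apply: (weighted_cintegrable (K := B * (2 * (1 + (- (rho * rcosh b)) ^+ 2)))).
  split.
    apply: ccontinuous_measurable; apply: (ccontinuous_comp cB) => x.
    by apply: cvgB; [exact: cvg_id|exact: cvg_cst].
  move=> x; apply: le_trans (H2 _) _.
  by rewrite -mulrA ler_wpM2l ?weight_shift // (weighted_ge0 wB).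
apply: eq_cint => t; rewrite /G /= -/(laplace_kernel w (t + - (rho * rcosh b))).
set p := rho * rcosh b.
have -> : laplace_kernel w t = laplace_kernel w p * laplace_kernel w (t - p).
  by rewrite /laplace_kernel -cexpD; congr cexp; rewrite rmorphB; ring.
have -> : cexp (- (omega0 * (t - p)))*i = cexp (- (omega0 * t))*i * cexp (omega0 * rho * rcosh b)*i.
  by rewrite -cexpD; congr cexp; apply: complex_eq; rewrite /p /=; ring.
by ring.
Qed.

End DiffractedWave.
(** * The wedge kernel *)

Section WedgeKernel.
Variable R : realType.
Local Notation C := R[i].
Implicit Types (x y theta : R).

(** The window is shifted downwards because the contour lies below the real axis. *)
Lemma sin_neq0_itv y : - (2 * pi) < y -> y < pi -> y <> 0 -> y <> - pi -> sin y != 0.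
Proof.
move=> y1 y2 /eqP y0 /eqP yp.
have [ygt|yle] := ltP 0 y.
  by rewrite gt_eqF // sin_gt0_pi // ygt.
have {yle}y0' : y < 0 by rewrite lt_neqAle y0.
have [yp1|yp1] := ltP (- pi) y.
  by rewrite -oppr_eq0 -sinN gt_eqF // sin_gt0_pi //; lra.
have {}yp1 : y < - pi by rewrite lt_neqAle yp.
have -> : sin y = sin (y + pi *+ 2) by rewrite sinD2pi.
by rewrite gt_eqF // sin_gt0_pi // mulr2n; lra.
Qed.

Lemma smooth_continuous (f : R -> C) : smooth f -> ccontinuous f.
Proof.
move=> sf; split=> x; apply/differentiable_continuous/derivable1_diffP.
  exact: (sf 0%N x).1.
exact: (sf 0%N x).2.
Qed.

Lemma continuous_step_bounded (f : R -> C) (s0 : R) : 0 < s0 -> ccontinuous f ->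
  (forall s : R, s <= 0 -> f s = 0) -> (forall s : R, s0 <= s -> f s = 1) ->
  exists F, forall s, cabs (f s) <= F.
Proof.
move=> s00 [c1 c2] f0 f1.
pose N s := ReC (f s) ^+ 2 + ImC (f s) ^+ 2.
have cN : continuous N.
  by move=> x; apply: cvgD; rewrite /GRing.exp /=; apply: cvgM;
    [exact: c1|exact: c1|exact: c2|exact: c2].
have [|c _ Nc] := @EVT_max R N 0 s0 (ltW s00); first exact: continuous_subspaceT.
have N0 : 0 <= N c by rewrite /N addr_ge0 ?sqr_ge0.
(* [N] is the squared modulus, and [|f| <= 1 + |f|^2]; the bound also covers the values 0 and 1
   outside []0, s0[]. *)
exists (1 + N c) => s.
have [sl|sg] := leP s 0; first by rewrite f0 // cabs0 addr_ge0.
have [sr|sl] := leP s0 s; first by rewrite f1 // cabs1 lerDl.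
have := Nc s; rewrite in_itv /= (ltW sg) (ltW sl) => /(_ isT).
by rewrite /N -sqr_cabs; have := sqr_ge0 (cabs (f s) - 1); rewrite !expr2; nra.
Qed.

Lemma rcosh_csinh_line x y : cos y = 0 -> sin y = -1 ->
  csinh (x +i* y) = - (rcosh x)*i.
Proof.
by move=> c s; rewrite csinhE c s; apply: complex_eq => /=; ring.
Qed.

Lemma cos_sin_line1 : cos (- (pi / 2)) = 0 :> R /\ sin (- (pi / 2)) = -1 :> R.
Proof. by rewrite cosN sinN cos_pihalf sin_pihalf. Qed.

Lemma cos_sin_line5 : cos (- (5 * pi / 2)) = 0 :> R /\ sin (- (5 * pi / 2)) = -1 :> R.
Proof.
have -> : - (5 * pi / 2) = - (pi / 2) - pi *+ 2 :> R by rewrite mulr2n; field.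
have E (a : R) : a = (a - pi *+ 2) + pi *+ 2 by rewrite subrK.
have [c s] := cos_sin_line1; split.
  by rewrite -[RHS]c [in RHS](E (- (pi / 2))) cosD2pi.
by rewrite -[RHS]s [in RHS](E (- (pi / 2))) sinD2pi.
Qed.

Variables (phi alpha theta : R).
Hypothesis phi_bounds : 0 < phi < pi.
Hypothesis alpha_bounds :
  Num.max (phi - pi / 2) 0 < alpha < Num.min (pi / 2) phi.
Hypothesis theta_in : Theta phi alpha theta.

(** The imaginary part of an argument of coth, where [a] collects the height of the line and the
    shift inside [H_N]. *)
Let angle (a : R) : R := q phi * (theta + a).

Let H_line (a x : R) : C :=
  ccoth ((q phi * x) +i* angle (a + (pi / 2 - alpha))) +
  ccoth ((q phi * x) +i* angle (a - (3 * pi / 2 - alpha))).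

Let H_lineE a x : H_N phi alpha ((x +i* a) + theta *i) = H_line a x.
Proof.
by rewrite /H_N /H_line; congr (ccoth _ + ccoth _);
  apply: complex_eq; rewrite !ReImCE /= /angle; ring.
Qed.

Let angles_neq0 :
  [/\ sin (angle (- (5 * pi / 2) + (pi / 2 - alpha))) != 0,
      sin (angle (- (5 * pi / 2) - (3 * pi / 2 - alpha))) != 0,
      sin (angle (- (pi / 2) + (pi / 2 - alpha))) != 0 &
      sin (angle (- (pi / 2) - (3 * pi / 2 - alpha))) != 0].
Proof.
have /andP[f0 fp] := phi_bounds.
have /andP[] := alpha_bounds; rewrite gt_max lt_min => /andP[_ a0] /andP[a1 a2].
have [/andP[t1 t2] [n1 n2]] := theta_in.
have p0 : 0 < pi :> R by exact: pi_gt0.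
have P0 : 0 < 2 * Phi phi by rewrite /Phi; lra.
(* Dividing by q turns the zeros 0 and - pi of sin into 0 and - 2 Phi; these
   are attained exactly at the excluded angles theta2 and theta1. *)
have key a : - (4 * Phi phi) < theta + a -> theta + a < 2 * Phi phi ->
    theta + a <> 0 -> theta + a <> - (2 * Phi phi) -> sin (angle a) != 0.
  move=> h1 h2 h3 h4; have E : angle a * (2 * Phi phi) = pi * (theta + a).
    by rewrite /angle /q mulrC mulrA mulrCA mulfV ?mulr1 // ?gt_eqF.
  apply: sin_neq0_itv.
  - by rewrite -(ltr_pM2r P0) E; nra.
  - by rewrite -(ltr_pM2r P0) E ltr_pM2l.
  - move=> A0; apply: h3; move: E; rewrite A0 mul0r => /esym/eqP.
    by rewrite mulf_eq0 gt_eqF //= => /eqP.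
  - move=> A0; apply: h4; move: E; rewrite A0 mulNr -mulrN.
    by move=> /(mulfI (lt0r_neq0 p0)) <-.
rewrite /theta1 in n1; rewrite /theta2 in n2; rewrite /Phi in key.
(* The four values of [theta + a] are [theta - 2 pi - alpha], [theta - 4 pi + alpha],
   [theta - alpha] and [theta - 2 pi + alpha]. Only the second can be [- 2 Phi], at [theta1], and
   only the last can be 0, at [theta2]. *)
split; apply: key; lra.
Qed.

Lemma H_N_line (a : R) : a = - (5 * pi / 2) \/ a = - (pi / 2) ->
  ccontinuous (fun x => H_N phi alpha ((x +i* a) + theta *i)) /\
  exists M, forall x, cabs (H_N phi alpha ((x +i* a) + theta *i)) <= M.
Proof.
move=> aE.
have [s1 s2] : sin (angle (a + (pi / 2 - alpha))) != 0 /\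
    sin (angle (a - (3 * pi / 2 - alpha))) != 0.
  by have [? ? ? ?] := angles_neq0; case: aE => ->.
rewrite (_ : (fun x => _) = H_line a); last by apply/funext => x; exact: H_lineE.
split.
  have L y : sin y != 0 -> ccontinuous (fun x => ccoth ((q phi * x) +i* y)).
    move=> s; apply: (@ccontinuous_comp _ (fun x => ccoth (x +i* y))).
      exact: ccontinuous_ccoth_line.
    exact: continuous_scale.
  by apply: ccontinuousD; exact: L.
exists (`|sin (angle (a + (pi / 2 - alpha)))|^-1 + `|sin (angle (a - (3 * pi / 2 - alpha)))|^-1) => x.
rewrite H_lineE; apply: le_trans (cabsD _ _) _.
by apply: lerD; exact: cabs_ccoth_le.
Qed.

Lemma Z_N_lineE x : Z_N phi alpha (x%:C + theta *i) =
  H_N phi alpha ((x +i* - (5 * pi / 2)) + theta *i) -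
  H_N phi alpha ((x +i* - (pi / 2)) + theta *i).
Proof.
by rewrite /Z_N; congr (H_N _ _ _ - H_N _ _ _); apply: complex_eq;
  rewrite !ReImCE /=; ring.
Qed.

Lemma Z_N_line : ccontinuous (fun x => Z_N phi alpha (x%:C + theta *i)) /\
  exists M, forall x, cabs (Z_N phi alpha (x%:C + theta *i)) <= M.
Proof.
have [c5 [M5 H5]] := H_N_line (or_introl (erefl _)).
have [c1 [M1 H1]] := H_N_line (or_intror (erefl _)).
rewrite (_ : (fun x => _) = (fun x => H_N phi alpha ((x +i* - (5 * pi / 2)) + theta *i) -
  H_N phi alpha ((x +i* - (pi / 2)) + theta *i))); last first.
  by apply/funext => x; exact: Z_N_lineE.
split; first exact: ccontinuousB.
exists (M5 + M1) => x; rewrite Z_N_lineE.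
by apply: le_trans (cabsB _ _) _; exact: lerD.
Qed.

(** The upper line is run from right to left and enters with a minus sign, as does the second term
    of [Z_N]. Each line converges by itself, [H_N] being bounded on it, so the two integrals may be
    merged. *)
Lemma C0_int_line (rho : R) (w : C) : 0 < rho -> 0 < ImC w ->
  C0_int (fun b => cexp (- (rho%:C * w * csinh b)) * H_N phi alpha (b + theta *i)) =
  cint (fun x => laplace_kernel w (rho * rcosh x) * Z_N phi alpha (x%:C + theta *i)).
Proof.
move=> rho0 w0.
have lineE (a : R) : cos a = 0 -> sin a = -1 ->
    line_int a (fun b => cexp (- (rho%:C * w * csinh b)) * H_N phi alpha (b + theta *i)) =
    cint (fun x => laplace_kernel w (rho * rcosh x) * H_N phi alpha ((x +i* a) + theta *i)).
  move=> ca sa; apply: eq_cint => x; rewrite rcosh_csinh_line //.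
  rewrite /laplace_kernel; congr (cexp _ * _).
  by apply: complex_eq; rewrite !ReImCE /=; ring.
have integrable a : a = - (5 * pi / 2) \/ a = - (pi / 2) ->
    cintegrable (fun x => laplace_kernel w (rho * rcosh x) * H_N phi alpha ((x +i* a) + theta *i)).
  move=> /H_N_line[cH [M HM]].
  have := weightedM (ccontinuous_measurable cH) HM (laplace_kernel_phase_weighted rho0 w0).
  by move=> /weighted_cintegrable; congr cintegrable; apply/funext => b; exact: mulrC.
have [c1 s1] := cos_sin_line1; have [c5 s5] := cos_sin_line5.
rewrite /C0_int !lineE // -cintB; [|by apply: integrable; left|by apply: integrable; right].
by apply: eq_cint => x; rewrite Z_N_lineE mulrBr.
Qed.

End WedgeKernel.

(** * Representation of the diffracted wave *)

Theorem theorem5p2 (R : realType) (omega0 phi alpha s0 : R) (f : R -> R[i])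
  (omega0_gt0 : 0 < omega0)
  (phi_bounds : 0 < phi < pi)
  (alpha_bounds :
     Num.max (phi - pi / 2) 0 < alpha < Num.min (pi / 2) phi)
  (s0_bounds : 0 < s0 < 1)
  (f_smooth : smooth f)
  (f_left : forall s : R, s <= 0 -> f s = 0)
  (f_right : forall s : R, s0 <= s -> f s = 1)
  (rho theta : R) (rho_gt0 : 0 < rho)
  (theta_in : Theta phi alpha theta) :
  (exists u_d : functional R,
     inverse_FL (u_d_hat omega0 phi alpha f rho theta) u_d) /\
  (forall u_d : functional R,
     inverse_FL (u_d_hat omega0 phi alpha f rho theta) u_d ->
     is_function u_d (u_d_formula omega0 phi alpha f rho theta)).
Proof.
have f_cont := smooth_continuous f_smooth.
have /andP[s00 _] := s0_bounds.
have [F f_le] := continuous_step_bounded s00 f_cont f_left f_right.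
have [Z_cont [M Z_le]] := Z_N_line phi_bounds alpha_bounds theta_in.
pose Z b := Z_N phi alpha (b%:C + theta *i).
pose k : R[i] := 1 *i / (4 * Phi phi)%:C.
pose A := wave_amplitude omega0 rho f Z.
have A_cont : ccontinuous A.
  exact: (wave_amplitude_continuous omega0 rho_gt0 f_left f_le f_cont Z_le Z_cont).
pose V t := cexp ((- (omega0 * t))*i) * A t.
have UE t : u_d_formula omega0 phi alpha f rho theta t = k * V t.
  rewrite /u_d_formula [X in _ * X = _](_ : _ = A t) // /V /k.
  by move: (_^-1) => d; ring.
have V_cont : ccontinuous V.
  apply: ccontinuousM => //; apply: ccontinuous_cexp; apply: ccontinuous_i => x.
  by apply: cvgN; exact: continuous_scale.
have V_causal t : t <= 0 -> V t = 0.
  by move=> t0; rewrite /V /A wave_amplitude_causal ?mulr0.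
have A_le := wave_amplitude_linear omega0 rho_gt0 f_left f_le f_cont Z_le Z_cont.
set K := 2 * _ * _ in A_le.
have V_le t : cabs (V t) <= K * `|t| by rewrite /V cabsM cabs_cexp_i mul1r A_le.
rewrite (_ : u_d_formula _ _ _ _ _ _ = fun t => k * V t); last exact/funext.
apply: (@causal_inverse_FL _ _ (cabs k * K)).
- by apply: ccontinuousM => //; exact: ccontinuous_cst.
- by move=> t t0; rewrite V_causal // mulr0.
- by move=> t; rewrite cabsM -mulrA ler_wpM2l ?cabs_ge0.
(* It remains to see that [u_d_hat] is [k] times the product which [laplace_wave] identifies with
   the Laplace integral of [V]. *)
move=> w w0; have [B wB] := laplace_integrand_weighted V_cont V_causal V_le w0.
rewrite /u_d_hat (C0_int_line phi_bounds alpha_bounds theta_in) // -mulrA.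
rewrite -(laplace_wave omega0 rho_gt0 f_left f_le f_cont Z_le Z_cont w0).
rewrite -/k -/Z -/A -cintZ; last exact: (weighted_cintegrable wB).
by apply: eq_cint => t; rewrite /V mulrCA.
Qed.
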